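(* Let $\boldsymbol H_e\in H^1(0,T;H(\mathrm{div}))$ be given, and let $\boldsymbol u\in C^1([0,T];\boldsymbol S)$, $\tilde p\in C^0([0,T];W)$, $\boldsymbol m\in C^1([0,T];\boldsymbol V)$, $\boldsymbol z\in C^0([0,T];\boldsymbol U)$, $\boldsymbol k\in C^0([0,T];\boldsymbol U)$, $\boldsymbol H\in C^0([0,T];\boldsymbol V)$ and $\varphi\in C^0([0,T];W)$ solve the weak ferrofluid problem (WP) described in the context. Define $$\mathcal E(t):=\|\boldsymbol u(\cdot,t)\|^2+\|\boldsymbol m(\cdot,t)\|^2+\mu_0\|\boldsymbol H(\cdot,t)\|^2,$$ $$\mathcal F(t):=2\Big(\eta\|\nabla\boldsymbol u\|^2+\sigma(1+\mu_0)\|\mathrm{div}\,\boldsymbol m\|^2+\sigma\|\boldsymbol k\|^2+\tfrac1\tau\|\boldsymbol m\|^2+\tfrac1\tau[\mu_0(1+\chi_0)+\chi_0]\|\boldsymbol H\|^2+\mu_0\beta\|\boldsymbol m\times\boldsymbol H\|^2\Big)(t).$$ Then there are positive constants $C_1,C_2$ depending only on $\eta,\mu_0,\chi_0,\tau,\beta,\sigma$ and $\Omega$ such that for all $t\in[0,T]$ $$\mathcal E(t)+C_1\int_0^t\mathcal F(s)\,ds\le\mathcal E(0)+C_2\int_0^t\Big(\|\boldsymbol H_e(\cdot,s)\|_{H(\mathrm{div})}^2+\|\partial_t\boldsymbol H_e(\cdot,s)\|^2\Big)ds.$$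
   Context: $\Omega\subset\mathbb R^3$ is a bounded, simply connected, convex domain with Lipschitz boundary and outward unit normal $\boldsymbol n$; $T>0$. $(\cdot,\cdot)$ and $\|\cdot\|$ are the $L^2(\Omega)$ inner product and norm for scalar or vector functions. $H(\mathrm{curl})=\{\boldsymbol v\in L^2(\Omega)^3:\mathrm{curl}\,\boldsymbol v\in L^2(\Omega)^3\}$, $H(\mathrm{div})=\{\boldsymbol v\in L^2(\Omega)^3:\mathrm{div}\,\boldsymbol v\in L^2(\Omega)\}$, $\|\boldsymbol v\|_{H(\mathrm{div})}=(\|\boldsymbol v\|^2+\|\mathrm{div}\,\boldsymbol v\|^2)^{1/2}$. $\boldsymbol S=H_0^1(\Omega)^3$, $\boldsymbol U=H_0(\mathrm{curl})=\{\boldsymbol v\in H(\mathrm{curl}):\boldsymbol v\times\boldsymbol n=0\text{ on }\partial\Omega\}$, $\boldsymbol V=H_0(\mathrm{div})=\{\boldsymbol v\in H(\mathrm{div}):\boldsymbol v\cdot\boldsymbol n=0\text{ on }\partial\Omega\}$, $W=L^2_0(\Omega)=\{v\in L^2(\Omega):\int_\Omega v=0\}$. The parameters $\eta,\mu_0,\sigma,\tau,\chi_0,\beta$ are positive constants. The known external magnetic field $\boldsymbol H_e$ satisfies $\boldsymbol H_e\cdot\boldsymbol n=0$ on $\partial\Omega\times(0,T]$. The initial data are $\boldsymbol u(\cdot,0)=\boldsymbol u_0$, $\boldsymbol m(\cdot,0)=\boldsymbol m_0$ with given $\boldsymbol u_0,\boldsymbol m_0$. Set $b(\boldsymbol v;\boldsymbol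 m,\boldsymbol F):=\frac12(\boldsymbol v\cdot\boldsymbol F,\mathrm{div}\,\boldsymbol m)-\frac12(\boldsymbol v\cdot\boldsymbol m,\mathrm{div}\,\boldsymbol F)$. Weak problem (WP) (weak form of Shliomis' ferrofluid model): for each time, $$(\partial_t\boldsymbol u,\boldsymbol v)-(\boldsymbol u\times\mathrm{curl}\,\boldsymbol u,\boldsymbol v)+\eta(\nabla\boldsymbol u,\nabla\boldsymbol v)-(\tilde p,\mathrm{div}\,\boldsymbol v)-\mu_0b(\boldsymbol v;\boldsymbol H,\boldsymbol m)-\tfrac{\mu_0}2(\boldsymbol v\times\boldsymbol k,\boldsymbol H)=0\quad\forall\boldsymbol v\in\boldsymbol S,$$ $$(\mathrm{div}\,\boldsymbol u,q)=0\quad\forall q\in W,$$ $$(\partial_t\boldsymbol m,\boldsymbol F)+b(\boldsymbol u;\boldsymbol m,\boldsymbol F)+\tfrac12(\boldsymbol u\times\boldsymbol F,\boldsymbol k)-\tfrac12(\mathrm{curl}\,\boldsymbol z,\boldsymbol F)+\sigma(\mathrm{curl}\,\boldsymbol k,\boldsymbol F)+\sigma(\mathrm{div}\,\boldsymbol m,\mathrm{div}\,\boldsymbol F)+\tfrac1\tau(\boldsymbol m,\boldsymbol F)-\tfrac{\chi_0}\tau(\boldsymbol H,\boldsymbol F)+\beta(\boldsymbol m\times(\boldsymbol m\times\boldsymbol H),\boldsymbol F)=0\quad\forall\boldsymbol F\in\boldsymbol V,$$ $$(\boldsymbol z,\boldsymbol\zeta)-(\boldsymbol u\times\boldsymbol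 m,\boldsymbol\zeta)=0\quad\forall\boldsymbol\zeta\in\boldsymbol U,\qquad(\boldsymbol k,\boldsymbol\kappa)-(\boldsymbol m,\mathrm{curl}\,\boldsymbol\kappa)=0\quad\forall\boldsymbol\kappa\in\boldsymbol U,$$ $$(\boldsymbol H,\boldsymbol G)+(\varphi,\mathrm{div}\,\boldsymbol G)=0\quad\forall\boldsymbol G\in\boldsymbol V,\qquad(\mathrm{div}\,\boldsymbol H+\mathrm{div}\,\boldsymbol m,r)+(\mathrm{div}\,\boldsymbol H_e,r)=0\quad\forall r\in W,$$ with the initial data above. *)

(* Defs.v *)
From HB Require Import structures.
From mathcomp Require Import all_boot all_order all_algebra.
From mathcomp Require Import all_classical all_reals all_analysis.

Set Implicit Arguments.
Unset Strict Implicit.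
Unset Printing Implicit Defensive.

Import Order.TTheory GRing.Theory Num.Theory numFieldNormedType.Exports.

Local Open Scope classical_set_scope.
Local Open Scope ring_scope.

(* Points of the Euclidean space are triples ((x0, x1), x2); this is the
   type on which the iterated product of Lebesgue measures lives.  Functions
   on a domain O are total functions, of which only the values on O matter;
   elements of L^2(O) are represented by (Borel) measurable functions. *)
Notation pt R :=
  (measurableTypeR R * measurableTypeR R * measurableTypeR R)%type.
Notation sfield R := (pt R -> R).
Notation vfield R := ('I_3 -> pt R -> R).
Notation tfield R := ('I_3 -> 'I_3 -> pt R -> R).

Definition leb3 {R : realType} : {measure set (pt R) -> \bar R} :=
  ((@lebesgue_measure R \x @lebesgue_measure R) \x @lebesgue_measure R)%E.

Section Space.
Context {R : realType}.
Implicit Types (O : set (pt R)) (x : pt R) (f g phi : sfield R)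
  (v w psi : vfield R) (G K : tfield R) (i j : 'I_3).

Definition ptcoord (i : 'I_3) x : R := [:: x.1.1; x.1.2; x.2]`_i.

Definition ebas (i : 'I_3) : pt R :=
  ((i == 0)%:R, (i == 1)%:R, (i == 2%:R)%:R).

(* Indices in 'I_3 are added modulo 3, so that the i-th component of a cross
   product is a_(i+1) b_(i+2) - a_(i+2) b_(i+1), and likewise for the curl. *)
Definition cross v w : vfield R := fun i x =>
  v (i + 1) x * w (i + 2%:R) x - v (i + 2%:R) x * w (i + 1) x.

Definition dot v w : sfield R := fun x => \sum_i v i x * w i x.

(** * The domain *)

Definition path_connected (A : set (pt R)) :=
  forall a b, A a -> A b -> exists c : R -> pt R,
    [/\ {within `[0, 1], continuous c}, c 0 = a, c 1 = b &
        forall t, t \in `[0, 1] -> A (c t)].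

Definition loops_contractible (A : set (pt R)) :=
  forall c : R -> pt R, {within `[0, 1], continuous c} -> c 0 = c 1 ->
    (forall t, t \in `[0, 1] -> A (c t)) ->
  exists h : R * R -> pt R,
    [/\ {within `[0, 1] `*` `[0, 1], continuous h},
        forall s t, s \in `[0, 1] -> t \in `[0, 1] -> A (h (s, t)),
        forall t, t \in `[0, 1] -> h (0, t) = c t,
        forall t, t \in `[0, 1] -> h (1, t) = c 0 &
        forall s, s \in `[0, 1] -> h (s, 0) = c 0 /\ h (s, 1) = c 0].

Definition simply_connected (A : set (pt R)) :=
  path_connected A /\ loops_contractible A.

(* Near each boundary point, in some orthonormal coordinate system (the rows
   of Q), the set is the strict epigraph of a Lipschitz function. *)
Definition lipschitz_boundary O :=
  forall x0, (closure O `\` O°) x0 ->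
  exists (Q : 'M[R]_3) (gam : R * R -> R),
    let y i x := \sum_j Q i j * ptcoord j x in
    [/\ Q *m Q^T = 1%:M, [lipschitz gam a | a in [set: R * R]] &
        \forall x \near x0, O x <-> gam (y 0 x, y 1 x) < y 2%:R x].

Definition admissible_domain O :=
  [/\ O !=set0 /\ open O, bounded_set O, simply_connected O,
      convex_set (O : set (convex_lmodType (pt R))) &
      lipschitz_boundary O].

(** * L^2 pairings and norms on O *)

Definition ip O f g : R := \int[leb3]_(x in O) (f x * g x).
Definition vip O v w : R := \int[leb3]_(x in O) dot v w x.
Definition tip O G K : R :=
  \int[leb3]_(x in O) (\sum_i \sum_j G i j x * K i j x).

(* The real-valued integral is total, with a meaningless value on functions
   that are not integrable; these predicates say that a pairing is genuine. *)
Definition ip_def O f g := leb3.-integrable O (fun x => (f x * g x)%:E).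
Definition vip_def O v w := leb3.-integrable O (fun x => (dot v w x)%:E).

Definition nsq O f : \bar R := (\int[leb3]_(x in O) (f x ^+ 2)%:E)%E.
Definition vnsq O v : \bar R := (\int[leb3]_(x in O) (dot v v x)%:E)%E.
Definition tnsq O G : \bar R :=
  (\int[leb3]_(x in O) (\sum_i \sum_j G i j x ^+ 2)%:E)%E.

Definition L2 O f := measurable_fun O f /\ (nsq O f < +oo)%E.
Definition vL2 O v := forall i, L2 O (v i).

(** * Smooth functions and classical differential operators *)

Definition partial i f : sfield R := fun x => 'D_(ebas i) f x.

Definition smooth f := forall l : seq 'I_3,
  let fl := foldr partial f l in
  continuous fl /\ forall x i, derivable fl x (ebas i).

Definition test_fun O f := smooth f /\
  exists K : set (pt R), [/\ compact K, K `<=` O & forall x, ~ K x -> f x = 0].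

Definition cgrad f : vfield R := fun i => partial i f.
Definition ccurl v : vfield R := fun i x =>
  partial (i + 1) (v (i + 2%:R)) x - partial (i + 2%:R) (v (i + 1)) x.

(** * Weak derivatives: the L^2(O) representative, when there is one *)

Definition is_wpartial O i f g :=
  L2 O g /\ forall phi, test_fun O phi ->
    ip O f (partial i phi) = - ip O g phi.
Definition is_wdiv O v g :=
  L2 O g /\ forall phi, test_fun O phi -> vip O v (cgrad phi) = - ip O g phi.
Definition is_wcurl O v w :=
  vL2 O w /\ forall psi, (forall i, test_fun O (psi i)) ->
    vip O v (ccurl psi) = vip O w psi.

Definition wpartial O i f : sfield R := get [set g | is_wpartial O i f g].
Definition wdiv O v : sfield R := get [set g | is_wdiv O v g].
Definition wcurl O v : vfield R := get [set w | is_wcurl O v w].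
Definition wgrad O v : tfield R := fun i j => wpartial O j (v i).

(** * Function spaces *)

Definition H1 O f := L2 O f /\ forall i, exists g, is_wpartial O i f g.
Definition h1sq O f : \bar R :=
  (nsq O f + \sum_(i < 3) nsq O (wpartial O i f))%E.

Definition H10 O f := H1 O f /\
  forall e : R, 0 < e -> exists2 phi, test_fun O phi &
    (h1sq O (fun x => f x - phi x)%R < e%:E)%E.

Definition Hdiv O v := vL2 O v /\ exists g, is_wdiv O v g.
Definition Hcurl O v := vL2 O v /\ exists w, is_wcurl O v w.
Definition hdivsq O v : \bar R := (vnsq O v + nsq O (wdiv O v))%E.
Definition hcurlsq O v : \bar R := (vnsq O v + vnsq O (wcurl O v))%E.

(* The traces v.n and v x n are the functionals defined by Green's formulas
     <v.n, phi>   = (v, grad phi) + (div v, phi),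
     <v x n, psi> = (v, curl psi) - (curl v, psi),
   on restrictions to O of smooth functions on the whole space (a dense
   subspace of H^1(O), resp. H^1(O)^3, for Lipschitz O). *)
Definition zero_normal_trace O v := forall phi, smooth phi ->
  vip O v (cgrad phi) + ip O (wdiv O v) phi = 0.
Definition zero_tangential_trace O v :=
  forall psi, (forall i, smooth (psi i)) ->
    vip O v (ccurl psi) - vip O (wcurl O v) psi = 0.

Definition spS O v := forall i, H10 O (v i).
Definition spU O v := Hcurl O v /\ zero_tangential_trace O v.
Definition spV O v := Hdiv O v /\ zero_normal_trace O v.
Definition spW O f := L2 O f /\ \int[leb3]_(x in O) f x = 0.

Definition spSsq O v : \bar R := (\sum_(i < 3) h1sq O (v i))%E.

End Space.

(** * Functions of time with values in a normed space of fields

   E is the vector space of representatives, X : set E the space and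
   N : E -> \bar R the square of its norm. *)
Section Time.
Context {R : realType} {E : lmodType R}.
Implicit Types (T : R) (X : set E) (N : E -> \bar R) (u du : R -> E).

Definition C0T T X N u :=
  (forall t, t \in `[0, T] -> X (u t)) /\
  forall t, t \in `[0, T] ->
    N (u s - u t) @[s --> within `[0, T] (nbhs t)] --> 0%E.

(* u is C^1 on [0,T], with derivative du (one-sided at 0 and T) *)
Definition C1T T X N u du :=
  [/\ C0T T X N u, C0T T X N du &
      forall t, t \in `[0, T] ->
        N ((s - t)^-1 *: (u s - u t) - du t)
          @[s --> within `[0, T] (dnbhs t)] --> 0%E].

Definition simple_fun X u :=
  exists (n : nat) (A : 'I_n -> set (measurableTypeR R)) (a : 'I_n -> E),
    (forall i, measurable (A i) /\ X (a i)) /\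
    forall t, u t = \sum_i \1_(A i) t *: a i.

Definition strongly_measurable T X N u :=
  exists s : nat -> R -> E, (forall n, simple_fun X (s n)) /\
    {ae @lebesgue_measure R, forall t, t \in `]0, T[ ->
       N (s n t - u t) @[n --> \oo] --> 0%E}.

Definition L2T T X N u :=
  [/\ forall t, t \in `]0, T[ -> X (u t), strongly_measurable T X N u &
      (\int[lebesgue_measure]_(t in `]0%R, T[) N (u t) < +oo)%E].

Definition test_fun1 T (f : R -> R) :=
  (forall n (t : R), derivable (derive1n n f) t 1) /\
  exists a b, [/\ 0 < a, b < T & forall t, t \notin `[a, b] -> f t = 0].

End Time.

(* He in H^1(0,T; H(div)), with weak time derivative dHe; as usual He is
   identified with its representative in C([0,T]; H(div)).  The identity
   int f' He = - int f dHe of Bochner integrals in L^2(O)^3 is expressed by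
   pairing with all elements of L^2(O)^3. *)
Definition H1T_Hdiv {R : realType} (O : set (pt R)) (T : R)
    (He dHe : R -> vfield R) :=
  [/\ L2T T (Hdiv O) (hdivsq O) He, L2T T (Hdiv O) (hdivsq O) dHe,
      C0T T (Hdiv O) (hdivsq O) He &
      forall (f : R -> R) (w : vfield R), test_fun1 T f -> vL2 O w ->
        \int[lebesgue_measure]_(t in `]0, T[) (derive1 f t * vip O (He t) w)
        = - \int[lebesgue_measure]_(t in `]0, T[) (f t * vip O (dHe t) w)].

(** * The weak problem *)
Section Ferrofluid.
Context {R : realType}.
Variables (O : set (pt R)) (eta mu0 sigma tau chi0 beta : R).

Definition b_form (v m F : vfield R) : R :=
  ip O (dot v F) (wdiv O m) / 2 - ip O (dot v m) (wdiv O F) / 2.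

Definition b_def (v m F : vfield R) :=
  ip_def O (dot v F) (wdiv O m) /\ ip_def O (dot v m) (wdiv O F).

(* The equations at one instant; ut, mt are the values of the time derivatives
   of u, m.  That an equation holds for a test function includes that its
   products of three or more fields are integrable (all other pairings are
   between elements of L^2). *)
Record WP_at (u ut : vfield R) (p : sfield R) (m mt z k H : vfield R)
    (phi : sfield R) (He : vfield R) : Prop := {
  WP_momentum_def : forall v, spS O v ->
    [/\ vip_def O (cross u (wcurl O u)) v, b_def v H m &
        vip_def O (cross v k) H];
  WP_momentum : forall v, spS O v ->
    vip O ut v - vip O (cross u (wcurl O u)) v
    + eta * tip O (wgrad O u) (wgrad O v) - ip O p (wdiv O v)
    - mu0 * b_form v H m - mu0 / 2 * vip O (cross v k) H = 0;
  WP_incompressible : forall q, spW O q -> ip O (wdiv O u) q = 0;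
  WP_magnetization_def : forall F, spV O F ->
    [/\ b_def u m F, vip_def O (cross u F) k &
        vip_def O (cross m (cross m H)) F];
  WP_magnetization : forall F, spV O F ->
    vip O mt F + b_form u m F + vip O (cross u F) k / 2
    - vip O (wcurl O z) F / 2 + sigma * vip O (wcurl O k) F
    + sigma * ip O (wdiv O m) (wdiv O F) + tau^-1 * vip O m F
    - chi0 / tau * vip O H F + beta * vip O (cross m (cross m H)) F = 0;
  WP_z_def : forall zeta, spU O zeta -> vip_def O (cross u m) zeta;
  WP_z : forall zeta, spU O zeta ->
    vip O z zeta - vip O (cross u m) zeta = 0;
  WP_k : forall kap, spU O kap -> vip O k kap - vip O m (wcurl O kap) = 0;
  WP_H : forall G, spV O G -> vip O H G + ip O phi (wdiv O G) = 0;
  WP_magnetostatic : forall r, spW O r ->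
    ip O (fun x => wdiv O H x + wdiv O m x) r + ip O (wdiv O He) r = 0
}.

Definition energy (u m H : vfield R) : \bar R :=
  (vnsq O u + vnsq O m + mu0%:E * vnsq O H)%E.

Definition dissipation (u m k H : vfield R) : \bar R :=
  (2%:E * (eta%:E * tnsq O (wgrad O u)
     + (sigma * (1 + mu0))%:E * nsq O (wdiv O m)
     + sigma%:E * vnsq O k + (tau^-1)%:E * vnsq O m
     + (tau^-1 * (mu0 * (1 + chi0) + chi0))%:E * vnsq O H
     + (mu0 * beta)%:E * vnsq O (cross m H)))%E.

End Ferrofluid.

(* Main.v *)
Require Import Defs.
From HB Require Import structures.
From mathcomp Require Import all_boot all_order all_algebra.
From mathcomp Require Import all_classical all_reals all_analysis measurable_realfun.
From mathcomp Require Import ring lra.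
Import Order.TTheory GRing.Theory Num.Theory numFieldNormedType.Exports.
Set Implicit Arguments.
Unset Strict Implicit.
Unset Printing Implicit Defensive.
Local Open Scope classical_set_scope.
Local Open Scope ring_scope.

(* Testing the momentum equation with u and the magnetization equation with m
   and with H, and eliminating z, k, H, phi by means of the other equations
   (curl z and curl k are divergence-free elements of V), gives at each instant
     F = - 2 (u', u) - 2 (m', m) + 2 mu0 (m', H)
         - 2 mu0 sigma (div He, div m) - 2 (mu0 + chi0) / tau (H, He).
   H has no time derivative, but it is quasi-static: the last two equations give
   (H(s), H(t)) = - (H(s), m(t) + He(t)), whence
     |H(t)|^2 - |H(s)|^2 = - (H(s) + H(t), m(t) + He(t) - m(s) - He(s)),
   and a real-induction argument on small steps yields
   d/dt |H|^2 = - 2 (m' + He', H) in integrated form.  So the derivative of the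
   energy is - F - 2 mu0 sigma (div He, div m) - 2 (mu0 + chi0) / tau (H, He)
   - 2 mu0 (He', H), and Young's inequality absorbs the factors div m and H into
   F / 2. *)

(** * Integrals and L^2 pairings *)

(** Weak divergences and curls are chosen representatives, determined only almost everywhere, and
    the total integrals are additive only on integrable functions. Pairings are therefore treated as
    semi-inner products that are linear on L^2 alone, and uniqueness of the weak divergence rests on
    the fundamental lemma of the calculus of variations, proved with explicit bump functions. At
    each instant the test with [H] is multiplied by [mu0] and subtracted: this cancels the coupling
    terms left by the test with [u] and produces the coefficients of div m, H and m x H in F. The
    other obstacle is the external field: its time derivative is weak, and pairings with it become
    measurable only after a modification on a null set. It enters through increments between
    interior times, obtained by testing the weak derivative with smooth ramps. Integrability of F in
    time is read off the instantaneous identity, whose right-hand side consists of pairings that are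
    continuous in time. *)

Section LowerIntegral.
Context d (T : measurableType d) (R : realType) (mu : {measure set T -> \bar R}).
Implicit Types (D A : set T) (f g : T -> \bar R).
Local Open Scope ereal_scope.

Import HBNNSimple.
(** A simple function below [f] is also below [g], so the two suprema compare without measurability.
    This matters for squared norms as functions of time. *)
Lemma ge0_le_integral_any D f g : (forall x, D x -> 0 <= f x) ->
  (forall x, D x -> f x <= g x) ->
  \int[mu]_(x in D) f x <= \int[mu]_(x in D) g x.
Proof.
move=> f0 fg; rewrite !ge0_integralE//; last first.
  by move=> x Dx; exact: le_trans (f0 _ Dx) (fg _ Dx).
apply: le_ereal_sup => _ [h hf <-]; exists h => // x.
by apply: le_trans (hf x) _; exact: lee_restrict.
Qed.

Let ge0_le_integral_off A f g : measurable A -> mu A = 0 ->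
  (forall x, 0 <= f x) -> (forall x, 0 <= g x) ->
  (forall x, ~ A x -> f x = g x) ->
  \int[mu]_x f x <= \int[mu]_x g x.
Proof.
move=> mA A0 f0 g0 fg; rewrite !ge0_integralTE//.
apply: le_ereal_sup => _ [h hf <-] /=.
have mCA : measurable (~` A) by exact: measurableC.
exists (proj_nnsfun h mCA) => [x|].
  rewrite /= mindicE; have [/set_mem nAx|_] := boolP (x \in ~` A).
    by rewrite mulr1 -fg.
  by rewrite mulr0.
rewrite -!integralT_nnsfun; apply: ae_eq_integral => //.
- by apply/measurable_EFinP; exact: measurable_funPT.
- by apply/measurable_EFinP; exact: measurable_funPT.
exists A; split => // x /=; apply: contra_notP => nAx _.
by rewrite mindicE mem_set// mulr1.
Qed.

Let ge0_eq_integral_off A f g : measurable A -> mu A = 0 ->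
  (forall x, 0 <= f x) -> (forall x, 0 <= g x) ->
  (forall x, ~ A x -> f x = g x) ->
  \int[mu]_x f x = \int[mu]_x g x.
Proof.
move=> mA A0 f0 g0 fg; apply/eqP; rewrite eq_le.
by rewrite !(@ge0_le_integral_off A)// => x nAx; rewrite fg.
Qed.

(* No measurability is needed: the integral of a nonnegative function is the
   supremum over the simple functions below it, which may be cut off outside A. *)
Lemma eq_integral_off A D f g : measurable A -> mu A = 0 ->
  (forall x, D x -> ~ A x -> f x = g x) ->
  \int[mu]_(x in D) f x = \int[mu]_(x in D) g x.
Proof.
move=> mA A0 fg; rewrite !(integral_mkcond D).
have fgD x : ~ A x -> (f \_ D) x = (g \_ D) x.
  by move=> nAx; rewrite /patch; case: ifPn => // /set_mem Dx; exact: fg.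
rewrite integralE [RHS]integralE; congr (_ - _);
  apply: (@ge0_eq_integral_off A) => // x nAx.
  by rewrite !funeposE fgD.
by rewrite !funenegE fgD.
Qed.

Lemma eq_Rintegral_off A D (f g : T -> R) : measurable A -> mu A = 0 ->
  (forall x, D x -> ~ A x -> f x = g x) ->
  (\int[mu]_(x in D) f x = \int[mu]_(x in D) g x)%R.
Proof.
move=> mA A0 fg; rewrite /Rintegral; congr fine.
by apply: (@eq_integral_off A) => // x Dx nAx; rewrite fg.
Qed.

End LowerIntegral.

(** * Boxes, and the measurability of open sets for the product sigma-algebra *)

Section Boxes.
Context {R : realType}.
Implicit Types (a b x : pt R) (O : set (pt R)).

Definition obox a b : set (pt R) :=
  `]a.1.1, b.1.1[ `*` `]a.1.2, b.1.2[ `*` `]a.2, b.2[.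

Definition cbox a b : set (pt R) :=
  `[a.1.1, b.1.1] `*` `[a.1.2, b.1.2] `*` `[a.2, b.2].

Definition ratpt (q : rat * rat * rat) : pt R :=
  (ratr q.1.1, ratr q.1.2, ratr q.2).

Lemma measurable_obox a b : measurable (obox a b).
Proof. by apply: measurableX; first apply: measurableX; exact: measurable_itv. Qed.

Lemma obox_cbox a b : obox a b `<=` cbox a b.
Proof.
by move=> x [[/= h1 h2] h3]; split; [split|]; apply: subset_itv_oo_cc.
Qed.

Lemma compact_cbox a b : compact (cbox a b).
Proof. by apply: compact_setX; first apply: compact_setX; exact: segment_compact. Qed.

(** The product topology is that of the sup norm, so rational bounds can be chosen coordinate by
    coordinate. The closed box is kept inside [O] so that functions supported in it are test
    functions. *)
Lemma rat_box O x : open O -> O x ->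
  exists p q, obox (ratpt p) (ratpt q) x /\ cbox (ratpt p) (ratpt q) `<=` O.
Proof.
move=> oO Ox; have : nbhs x O by exact: open_nbhs_nbhs.
rewrite -nbhs_ballE => -[e /= e0 xeO].
have rb (t : R) : exists p q : rat,
    (ratr p : R) < t < ratr q /\ forall s, ratr p <= s <= ratr q -> ball t e s.
  have [p] := @rat_in_itvoo R (t - e) t ltac:(lra).
  have [q] := @rat_in_itvoo R t (t + e) ltac:(lra).
  rewrite !in_itv/= => /andP[tq qe] /andP[ep pt']; exists p, q; split.
    by rewrite pt' tq.
  move=> s /andP[ps sq].
  by rewrite /ball/= ltr_norml; apply/andP; split; lra.
have [p1 [q1 [x1 h1]]] := rb x.1.1; have [p2 [q2 [x2 h2]]] := rb x.1.2.
have [p3 [q3 [x3 h3]]] := rb x.2.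
exists (p1, p2, p3), (q1, q2, q3); split.
  by split; [split|]; rewrite /= in_itv.
move=> s [[]]; rewrite /= !in_itv/= => s1 s2 s3; apply: xeO.
by split; [split|]; [exact: h1|exact: h2|exact: h3].
Qed.

Lemma open_rat_boxes O : open O ->
  O = \bigcup_(k in [set k : (rat * rat * rat) * (rat * rat * rat) |
         cbox (ratpt k.1) (ratpt k.2) `<=` O]) obox (ratpt k.1) (ratpt k.2).
Proof.
move=> oO; apply/seteqP; split=> [x Ox|x [k kO /obox_cbox]]; last exact: kO.
by have [p [q [h1 h2]]] := rat_box oO Ox; exists (p, q).
Qed.

Lemma open_pt_measurable O : open O -> measurable O.
Proof.
move=> /open_rat_boxes ->; rewrite bigcup_mkcond.
apply: countable_bigcupT_measurable => // k.
by case: ifP => _; [exact: measurable_obox|exact: measurable0].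
Qed.

Lemma continuous_measurable_pt (f : pt R -> R) (D : set (pt R)) :
  measurable D -> continuous f -> measurable_fun D f.
Proof.
move=> mD cf; apply: (measurable_funS measurableT) => //.
apply: (measurability _ (RGenOpens.measurableE R)) => _ [_ [a [b ->] <-]].
rewrite setTI; apply: open_pt_measurable.
by apply: open_comp => // ? _; exact: cf.
Qed.

Lemma obox_finite a b : (leb3 (obox a b) < +oo :> \bar R)%E.
Proof.
have m12 : measurable (`]a.1.1, b.1.1[ `*` `]a.1.2, b.1.2[ :
    set (measurableTypeR R * measurableTypeR R)).
  by apply: measurableX; exact: measurable_itv.
have -> : leb3 (obox a b) = (((@lebesgue_measure R \x @lebesgue_measure R)
    (`]a.1.1, b.1.1[ `*` `]a.1.2, b.1.2[)) * lebesgue_measure (`]a.2, b.2[%classic : set R))%E.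
  by apply: product_measure1E => //; exact: measurable_itv.
rewrite product_measure1E//; [|exact: measurable_itv..].
rewrite /= !lebesgue_measure_itv; do 3 case: ifP => _;
  by rewrite -?EFinB -?EFinM ?mul0e ?mule0 ?ltry.
Qed.

Lemma bounded_leb3_finite O : measurable O -> bounded_set O -> (leb3 O < +oo)%E.
Proof.
move=> mO /= [M [Mr hM]].
pose N : R := `|M| + 1.
have ON x : O x -> `|x| <= N.
  by move=> Ox; apply: hM Ox; rewrite /N (le_lt_trans (ler_norm _)) ?ltrDl.
have inN (y : R) : `|y| <= N -> y \in `]- N - 1, N + 1[.
  by rewrite in_itv/= ler_norml => /andP[h1 h2]; apply/andP; split; lra.
have sub : O `<=` obox ((- N - 1, - N - 1), - N - 1) ((N + 1, N + 1), N + 1).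
  move=> [[x1 x2] x3] /ON; rewrite !ge_max => /andP[/andP[h1 h2] h3].
  by split; [split|]; exact: inN.
apply: le_lt_trans (obox_finite _ _).
exact: (le_measure leb3 (mem_set mO) (mem_set (measurable_obox _ _)) sub).
Qed.
End Boxes.

(** Linearity is required on [X] only, because a total integral is additive only on integrable
    functions. Definiteness is left out because two representatives of one L^2 class are different
    functions. *)
Record semi_ip {R : realType} {E : lmodType R} (X : set E) (B : E -> E -> R) :
    Prop := SemiIp {
  sip0 : X 0;
  sip_clos : forall a x y, X x -> X y -> X (a *: x + y);
  sipC : forall x y, B x y = B y x;
  sip_lin : forall a x y z, X x -> X y -> X z ->
    B (a *: x + y) z = a * B x z + B y z;
  sip_ge0 : forall x, 0 <= B x x
}.

Section SemiIpTheory.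
Context {R : realType} {E : lmodType R} {X : set E} {B : E -> E -> R}.
Hypothesis HB : semi_ip X B.
Implicit Types (x y z : E) (a : R).

Lemma sipXD x y : X x -> X y -> X (x + y).
Proof. by move=> Xx Xy; rewrite -[x]scale1r; exact: (sip_clos HB). Qed.

Lemma sipXZ a x : X x -> X (a *: x).
Proof. by move=> Xx; rewrite -[_ *: _]addr0; apply: (sip_clos HB) => //; exact: (sip0 HB). Qed.

Lemma sipXB x y : X x -> X y -> X (x - y).
Proof. by move=> Xx Xy; rewrite -scaleN1r; apply: sipXD => //; exact: sipXZ. Qed.

Lemma sipDl x y z : X x -> X y -> X z -> B (x + y) z = B x z + B y z.
Proof. by move=> Xx Xy Xz; rewrite -[x]scale1r (sip_lin HB)// mul1r scale1r. Qed.

Lemma sip0l z : X z -> B 0 z = 0.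
Proof.
by move=> Xz; have := sipDl (sip0 HB) (sip0 HB) Xz; rewrite addr0; lra.
Qed.

Lemma sipZl a x z : X x -> X z -> B (a *: x) z = a * B x z.
Proof.
move=> Xx Xz; rewrite -[_ *: _]addr0 (sip_lin HB)// ?sip0l ?addr0//.
exact: (sip0 HB).
Qed.

Lemma sipBl x y z : X x -> X y -> X z -> B (x - y) z = B x z - B y z.
Proof.
by move=> Xx Xy Xz; rewrite -scaleN1r sipDl ?sipZl ?mulN1r//; exact: sipXZ.
Qed.

Lemma sipDr x y z : X x -> X y -> X z -> B z (x + y) = B z x + B z y.
Proof. by move=> *; rewrite (sipC HB) sipDl// !(sipC HB z). Qed.

Lemma sipZr a x z : X x -> X z -> B z (a *: x) = a * B z x.
Proof. by move=> *; rewrite (sipC HB) sipZl// (sipC HB z). Qed.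

Lemma sipBr x y z : X x -> X y -> X z -> B z (x - y) = B z x - B z y.
Proof. by move=> *; rewrite (sipC HB) sipBl// !(sipC HB z). Qed.

Lemma sip_young (e : R) x y : 0 < e -> X x -> X y ->
  2 * `|B x y| <= e * B x x + e^-1 * B y y.
Proof.
move=> e0 Xx Xy.
(* Expand the square of [e *: x + c *: y] and divide by [e]; [c = 1] and [c = -1] bound the two
   signs of [B x y]. *)
have key (c : R) : - (2 * (c * B x y)) <= e * B x x + c ^+ 2 * (e^-1 * B y y).
  have := sip_ge0 HB (e *: x + c *: y).
  have Xex : X (e *: x) by exact: sipXZ.
  have Xcy : X (c *: y) by exact: sipXZ.
  rewrite !(sipDl, sipDr, sipZl, sipZr)//; [|exact: sipXD..].
  rewrite (sipC HB y x) => h; rewrite -subr_ge0.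
  have -> : e * B x x + c ^+ 2 * (e^-1 * B y y) - - (2 * (c * B x y)) =
    e^-1 * (e * (e * B x x) + e * (c * B x y) + (c * (e * B x y) + c * (c * B y y))).
    by field; rewrite gt_eqF.
  by rewrite mulr_ge0// ?invr_ge0 ?(ltW e0)//; lra.
have := key 1; have := key (-1).
rewrite sqrrN !expr1n !mul1r.
by case: (lerP 0 (B x y)) => h h1 h2; [rewrite ger0_norm//|rewrite ltr0_norm//]; lra.
Qed.

Definition snorm x := Num.sqrt (B x x).

Lemma snorm_ge0 x : 0 <= snorm x. Proof. exact: sqrtr_ge0. Qed.

Lemma snorm_sqr x : snorm x ^+ 2 = B x x.
Proof. by rewrite sqr_sqrtr// (sip_ge0 HB). Qed.

Lemma sip_CS x y : X x -> X y -> `|B x y| <= snorm x * snorm y.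
Proof.
move=> Xx Xy; apply/ler_addgt0Pr => d d0.
(* weights [e = (|y| + d') / (|x| + d')] make both sides of Young comparable *)
pose s := snorm x; pose t := snorm y.
have s0 : 0 <= s by exact: snorm_ge0.
have t0 : 0 <= t by exact: snorm_ge0.
(* This [k] is the shift [d'] of the weights. It must be positive because [s] or [t] may vanish; the
   error in the doubled inequality is [k * (s + t)], at most [d]. *)
pose k := Num.min 1 (d / (s + t + 1)).
have st1 : 0 < s + t + 1 by lra.
have k0 : 0 < k by rewrite lt_min ltr01 divr_gt0.
have kd : k * (s + t + 1) <= d by rewrite -ler_pdivlMr// ge_min lexx orbT.
have k1 : k <= 1 by rewrite ge_min lexx.
have sk : 0 < s + k by lra.
have tk : 0 < t + k by lra.
have := sip_young (divr_gt0 tk sk) Xx Xy.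
rewrite -!snorm_sqr -/s -/t invf_div => h.
have h1 : (t + k) / (s + k) * s ^+ 2 <= (t + k) * s.
  rewrite mulrAC ler_pdivrMr// expr2 -!mulrA ler_pM2l//.
  by rewrite ler_wpM2l//; lra.
have h2 : (s + k) / (t + k) * t ^+ 2 <= (s + k) * t.
  rewrite mulrAC ler_pdivrMr// expr2 -!mulrA ler_pM2l//.
  by rewrite ler_wpM2l//; lra.
have : k * (s + t) <= d by apply: le_trans kd; rewrite ler_pM2l//; lra.
by nra.
Qed.

End SemiIpTheory.
Arguments snorm {R E} B x.

(** * The L^2 pairings of scalar and vector fields as semi-inner products *)

Section Pairing.
Context {R : realType} (O : set (pt R)) (mO : measurable O).
Implicit Types (f g h : sfield R) (v w z : vfield R) (a : R).

Lemma L2_integrable_sqr f : L2 O f -> ip_def O f f.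
Proof.
move=> [mf f2]; apply/integrableP; split.
  by apply/measurable_EFinP; exact: measurable_funM.
move: f2; rewrite /nsq; under eq_integral do rewrite expr2.
by under [X in _ -> (X < _)%E]eq_integral do rewrite /= ger0_norm ?sqr_ge0//.
Qed.

Lemma L2_ip_def f g : L2 O f -> L2 O g -> ip_def O f g.
Proof.
move=> Lf Lg; have If := L2_integrable_sqr Lf; have Ig := L2_integrable_sqr Lg.
apply: (le_integrable mO) (integrableD mO If Ig).
  by apply/measurable_EFinP; apply: measurable_funM; [case: Lf|case: Lg].
move=> x _; rewrite /= lee_fin.
rewrite [leRHS]ger0_norm ?addr_ge0 -?expr2 ?sqr_ge0// normrM.
have := sqr_ge0 (`|f x| - `|g x|); have := sqr_ge0 (`|f x|); have := sqr_ge0 (`|g x|).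
rewrite -(real_normK (num_real (f x))) -(real_normK (num_real (g x))).
by rewrite !expr2; move: (`|f x|) (`|g x|) => r s; nra.
Qed.

Lemma nsqE f : L2 O f -> nsq O f = (ip O f f)%:E.
Proof.
move=> /L2_integrable_sqr If; rewrite /ip /Rintegral fineK; last exact: integrable_fin_num.
by apply: eq_integral => x _; rewrite expr2.
Qed.

Lemma ipC f g : ip O f g = ip O g f.
Proof. by apply: eq_Rintegral => x _; rewrite mulrC. Qed.

Lemma L2_lin a f g : L2 O f -> L2 O g -> L2 O (a *: f + g).
Proof.
move=> Lf Lg; have [mf _] := Lf; have [mg _] := Lg.
split; first by apply: measurable_funD => //; exact: measurable_funM.
have : leb3.-integrable O (fun x => (a ^+ 2)%:E * (f x * f x)%:E +
    ((2 * a)%:E * (f x * g x)%:E + (g x * g x)%:E))%E.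
  apply: integrableD => //; last apply: integrableD => //.
  - by apply: integrableZl => //; exact: L2_integrable_sqr.
  - by apply: integrableZl => //; exact: L2_ip_def.
  - exact: L2_integrable_sqr.
move=> /integrableP[_]; apply: le_lt_trans.
apply: ge0_le_integral_any => x _; first by rewrite lee_fin sqr_ge0.
rewrite -!EFinM -!EFinD lee_fin; apply: le_trans (ler_norm _).
rewrite le_eqVlt; apply/orP; left; apply/eqP.
rewrite (_ : (a *: f + g) x = a * f x + g x)//; ring.
Qed.

Lemma L2_0 : L2 O (0 : sfield R).
Proof.
split; first exact: measurable_cst.
by rewrite /nsq; under eq_integral do rewrite expr0n; rewrite integral0.
Qed.

Lemma ip_lin a f g h : L2 O f -> L2 O g -> L2 O h ->
  ip O (a *: f + g) h = a * ip O f h + ip O g h.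
Proof.
move=> Lf Lg Lh; rewrite /ip -RintegralZl//; last exact: L2_ip_def.
rewrite -RintegralD//; last exact: L2_ip_def.
  by apply: eq_Rintegral => x _; rewrite /= mulrDl mulrA.
by apply: (integrableZl mO a (L2_ip_def Lf Lh)).
Qed.

Lemma ip_ge0 f : 0 <= ip O f f.
Proof. by apply: Rintegral_ge0 => x _; rewrite -expr2 sqr_ge0. Qed.

Lemma vL2_lin a v w : vL2 O v -> vL2 O w -> vL2 O (a *: v + w).
Proof. by move=> Lv Lw i; exact: L2_lin. Qed.

Lemma vL2_0 : vL2 O (0 : vfield R).
Proof. by move=> i; exact: L2_0. Qed.

Lemma vL2_vip_def v w : vL2 O v -> vL2 O w -> vip_def O v w.
Proof.
move=> Lv Lw; rewrite /vip_def /dot.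
apply: (eq_integrable mO (fun x => \sum_(i < 3) (v i x * w i x)%:E)%E).
  by move=> x _; rewrite sumEFin.
by apply: integrable_sum => // i _; exact: L2_ip_def.
Qed.

Lemma vip_sum v w : vL2 O v -> vL2 O w -> vip O v w = \sum_i ip O (v i) (w i).
Proof.
move=> Lv Lw; apply: EFin_inj; rewrite /vip /Rintegral fineK; last first.
  by apply: integrable_fin_num => //; exact: vL2_vip_def.
rewrite -sumEFin; under eq_integral do rewrite /dot -sumEFin.
rewrite integral_sum//; last by move=> i; exact: L2_ip_def.
apply: eq_bigr => i _; rewrite fineK//; apply: integrable_fin_num => //.
exact: L2_ip_def.
Qed.

Lemma vnsqE v : vL2 O v -> vnsq O v = (vip O v v)%:E.
Proof.
move=> Lv; rewrite /vip /Rintegral fineK; last first.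
  by apply: integrable_fin_num => //; exact: vL2_vip_def.
by [].
Qed.

Lemma vipC v w : vip O v w = vip O w v.
Proof.
by apply: eq_Rintegral => x _; apply: eq_bigr => i _; rewrite mulrC.
Qed.

Lemma vip_lin a v w z : vL2 O v -> vL2 O w -> vL2 O z ->
  vip O (a *: v + w) z = a * vip O v z + vip O w z.
Proof.
move=> Lv Lw Lz; rewrite !vip_sum//; last exact: vL2_lin.
by rewrite mulr_sumr -big_split; apply: eq_bigr => i _; exact: ip_lin.
Qed.

Lemma vip_ge0 v : 0 <= vip O v v.
Proof.
by apply: Rintegral_ge0 => x _; apply: sumr_ge0 => i _; rewrite -expr2 sqr_ge0.
Qed.

Lemma ip_semi_ip : semi_ip (L2 O : set (sfield R)) (ip O).
Proof.
split; [exact: L2_0|exact: L2_lin|exact: ipC|exact: ip_lin|exact: ip_ge0].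
Qed.

Lemma vip_semi_ip : semi_ip (vL2 O : set (vfield R)) (vip O).
Proof.
split; [exact: vL2_0|exact: vL2_lin|exact: vipC|exact: vip_lin|exact: vip_ge0].
Qed.

End Pairing.

(** * Smooth functions and test functions *)

Section DeriveExtra.
Context {R : realType} {V : normedModType R}.
Implicit Types (f g : V -> R) (x v : V) (d : R).

Lemma is_derive_cvg f x v d :
  h^-1 *: (f (h *: v + x) - f x) @[h --> 0^'] --> d <-> is_derive x v f d.
Proof.
split=> [fd|[dv <-]]; last exact: dv.
by split; [apply/cvg_ex; exists d|exact: cvg_lim].
Qed.

(** Reduces directional derivatives to one variable, where the product rule and the mean value
    theorem are applied. *)
Lemma is_derive_lineP f x v d :
  is_derive (0 : R) 1 (fun h : R => f (h *: v + x)) d <-> is_derive x v f d.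
Proof.
pose phi (h : R) := f (h *: v + x).
have E : (fun h : R => h^-1 *: ((phi \o shift 0) h%:A - phi 0)) =
    (fun h => h^-1 *: (f (h *: v + x) - f x)).
  by apply/funext => h; rewrite /phi/= [_%:A]mulr1 addr0 scale0r add0r.
rewrite -is_derive_cvg; split=> [[dv <-]|fd].
  by have := dv; rewrite /derivable /derive -/phi E.
by split; [apply/cvg_ex; exists d; rewrite E|apply: cvg_lim => //; rewrite E].
Qed.

Lemma near_is_derive f g x v d : (\forall y \near x, f y = g y) ->
  is_derive x v f d -> is_derive x v g d.
Proof.
move=> fg; rewrite -!is_derive_cvg; apply: cvg_trans.
apply: near_eq_cvg; have fgx := nbhs_singleton fg; near=> h.
rewrite fgx; congr (_ *: (_ - _)); near: h; apply: nbhs_dnbhs.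
have : h *: v + x @[h --> (0 : R)] --> x.
  rewrite -[X in _ --> X]add0r -[X in _ --> X + _](scale0r v).
  by apply: cvgD; [apply: cvgZl; exact: cvg_id|exact: cvg_cst].
by move=> /(_ _ fg).
Unshelve. all: by end_near. Qed.

End DeriveExtra.

Section SmoothLine.
Context {R : realType}.
Implicit Types (f g : R -> R) (x y : R) (k n : nat).

(* The functions [flat k] are closed, up to linear combinations, under
   derivation, and [flat 0] is the classical flat function [exp (- 1 / x)]. *)
Definition flat k x : R := if 0 < x then x^-1 ^+ k * expR (- x^-1) else 0.

(** The [n]-th power of [y / n <= 1 + y / n <= expR (y / n)]. *)
Lemma expR_ge_pow n y : 0 <= y -> y ^+ n <= (n ^ n)%:R * expR y.
Proof.
move=> y0; case: n => [|n]; first by rewrite mul1r expr0 -expR0 ler_expR.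
have n0 : 0 < n.+1%:R :> R by rewrite ltr0n.
have -> : expR y = expR (y / n.+1%:R) ^+ n.+1.
  by rewrite -expRM_natl mulrC divfK// gt_eqF.
rewrite natrX -exprMn lerXn2r ?nnegrE// ?mulr_ge0 ?expR_ge0//.
rewrite mulrC -ler_pdivrMr//; apply: le_trans (expR_ge1Dx _).
by rewrite lerDr.
Qed.

Lemma flat_ge0 k x : 0 <= flat k x.
Proof.
rewrite /flat; case: ifPn => // x0.
by rewrite mulr_ge0 ?expR_ge0// exprn_ge0// invr_ge0 ltW.
Qed.

Lemma flat_le k x : flat k x <= (k ^ k)%:R.
Proof.
rewrite /flat; case: ifPn => // x0; rewrite expRN ler_pdivrMr ?expR_gt0//.
by apply: expR_ge_pow; rewrite invr_ge0 ltW.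
Qed.

(** For positive [x], [flat k x = x * flat k.+1 x], and the last factor is bounded. At the origin
    the difference quotient of [flat k] is [flat k.+1] on the right and 0 on the left, so this bound
    forces the limit 0 there. *)
Lemma flat_le_lin k x : 0 < x -> flat k x <= x * (k.+1 ^ k.+1)%:R.
Proof.
move=> x0; rewrite -ler_pdivrMl//; apply: le_trans (flat_le k.+1 x).
by rewrite /flat x0 exprS mulrA.
Qed.

Lemma flat_derive k x :
  is_derive x 1 (flat k) (flat k.+2 x - k%:R * flat k.+1 x).
Proof.
have [x0|x0|<-] := ltgtP 0 x.
- apply: (@near_is_derive R R (fun y => y^-1 ^+ k * expR (- y^-1))).
    by near=> y; rewrite /flat ifT//; near: y; exact: lt_nbhsr.
  have xn0 : x != 0 by rewrite gt_eqF.
  have dV : is_derive x 1 (fun y : R => y^-1) (- x ^- 2).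
    have := @is_deriveV R id x 1 1 xn0 (is_derive_id x 1).
    by rewrite /GRing.scale/= mulr1.
  have dE : is_derive x 1 (expR \o (fun y : R => - y^-1)) (expR (- x^-1) * x ^- 2).
    apply: is_derive1_comp; rewrite -[X in is_derive _ _ _ X]opprK.
    exact: is_deriveN.
  have -> : (fun y : R => y^-1 ^+ k * expR (- y^-1)) =
      (fun y : R => y^-1) ^+ k * (expR \o (fun y : R => - y^-1)).
    apply/funext => y; rewrite [RHS](_ : _ =
      ((fun z : R => z^-1) ^+ k) y * expR (- y^-1))//.
    by rewrite exprfctE.
  apply: is_derive_eq (is_deriveM (is_deriveX k dV) dE) _.
  rewrite exprfctE /flat x0 /GRing.scale/= -exprVn.
  by case: k => [|k]; rewrite /= ?exprS; ring.
- rewrite {2 3}/flat (lt_gtF x0) mulr0 subr0.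
  apply: (@near_is_derive R R (cst 0)).
  by near=> y; rewrite /flat ifF//; apply: lt_gtF; near: y; exact: lt_nbhsl.
- rewrite {2 3}/flat ltxx mulr0 subr0; apply/is_derive_cvg.
  have C0 : 0 <= (k.+2 ^ k.+2)%:R :> R by [].
  set C : R := (k.+2 ^ k.+2)%:R in C0.
  have limC : `|h| * C @[h --> (0 : R)^'] --> (0 : R).
    have : `|h| * C @[h --> (0 : R)^'] --> `|0 : R| * C.
      by apply: cvgMl; apply: cvg_norm; exact: nbhs_dnbhs.
    by rewrite normr0 mul0r.
  apply: (@squeeze_cvgr _ _ _ _ (fun h : R => - (`|h| * C)) (fun h : R => `|h| * C)).
  + near=> h; rewrite [_%:A]mulr1 addr0 {2 4}/flat ltxx subr0 /GRing.scale/=.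
    have [h0|h0] := ltP 0 h; last first.
      by rewrite /flat ltNge h0/= mulr0 oppr_le0 !mulr_ge0.
    have hge : 0 <= h by exact: ltW.
    have hV : 0 <= h^-1 by rewrite invr_ge0.
    have := flat_le_lin k.+1 h0; rewrite /flat h0 exprS gtr0_norm// -mulrA => ->.
    by rewrite andbT (@le_trans _ _ 0)// ?oppr_le0 ?mulr_ge0 ?expR_ge0// ?exprn_ge0//.
  + by rewrite -[X in _ --> X]oppr0; exact: cvgN.
  + exact: limC.
Unshelve. all: by end_near. Qed.

(** A syntactic class: the derivative of a member is again a member, so one induction on the
    construction gives derivatives of every order, with no formulas for iterated derivatives of
    products or quotients. *)
Inductive sm : (R -> R) -> Prop :=
| sm_flat k : sm (flat k)
| sm_cst (c : R) : sm (cst c)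
| sm_add f g : sm f -> sm g -> sm (fun x => f x + g x)
| sm_mul f g : sm f -> sm g -> sm (fun x => f x * g x)
| sm_inv f : sm f -> (forall x, f x != 0) -> sm (fun x => (f x)^-1)
| sm_aff f (a b : R) : sm f -> sm (fun x => f (a * x + b)).

Lemma sm_derive f : sm f -> exists2 g, sm g & forall x, is_derive x 1 f (g x).
Proof.
elim=> {f} [k|c|f g _ [df sdf hf] _ [dg sdg hg]|f g sf [df sdf hf] sg [dg sdg hg]|
  f sf [df sdf hf] fn0|f a b _ [df sdf hf]].
- exists (fun x => flat k.+2 x + cst (- k%:R) x * flat k.+1 x).
    by apply: sm_add; [exact: sm_flat|apply: sm_mul; [exact: sm_cst|exact: sm_flat]].
  by move=> x; rewrite /= mulNr; exact: flat_derive.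
- exists (cst 0); first exact: sm_cst.
  by move=> x; exact: is_derive_cst.
- by exists (fun x => df x + dg x); [exact: sm_add|move=> x; exact: is_deriveD].
- exists (fun x => f x * dg x + g x * df x); last by move=> x; exact: is_deriveM.
  by apply: sm_add; exact: sm_mul.
- exists (fun x => cst (-1) x * ((f x)^-1 * (f x)^-1) * df x).
    apply: sm_mul => //; apply: sm_mul; first exact: sm_cst.
    by apply: sm_mul; exact: sm_inv.
  move=> x; apply: is_derive_eq (is_deriveV (fn0 x) (hf x)) _.
  by rewrite /GRing.scale/= mulN1r -exprVn expr2.
- exists (fun x => df (a * x + b) * cst a x).
    by apply: sm_mul; [exact: sm_aff|exact: sm_cst].
  move=> x; apply: (@is_derive1_comp _ f (fun x => a * x + b)) => //.
  apply: is_derive_eq (is_deriveD (is_deriveZ a (is_derive_id x 1)) (is_derive_cst b x 1)) _.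
  by rewrite addr0 [LHS]mulr1.
Qed.

Lemma sm_derivable f x : sm f -> derivable f x 1.
Proof. by move=> /sm_derive[g _ /(_ x)[]]. Qed.

Lemma sm_derive1 f : sm f -> sm (derive1 f).
Proof.
move=> /sm_derive[g sg fg]; suff -> : derive1 f = g by [].
by apply/funext => x; rewrite derive1E; have [] := fg x.
Qed.

Lemma sm_derive1n f n : sm f -> sm (derive1n n f).
Proof. by move=> sf; elim: n => // n ih; exact: sm_derive1. Qed.

Lemma sm_is_derive f x : sm f -> is_derive x 1 f (derive1 f x).
Proof. by move=> /(@sm_derivable _ x) df; rewrite derive1E; exact: DeriveDef. Qed.

Lemma sm_continuous f : sm f -> continuous f.
Proof.
by move=> sf x; apply/differentiable_continuous/derivable1_diffP/sm_derivable.
Qed.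

Lemma flat0_homo x y : x <= y -> flat 0 x <= flat 0 y.
Proof.
rewrite /flat !expr0 !mul1r => xy; case: ifPn => x0.
  by rewrite (lt_le_trans x0 xy) ler_expR lerN2 lef_pV2 ?posrE// (lt_le_trans x0).
by case: ifPn => // _; exact: expR_ge0.
Qed.

Lemma flat0_gt0 x : 0 < x -> 0 < flat 0 x.
Proof. by move=> x0; rewrite /flat x0 expr0 mul1r expR_gt0. Qed.

Lemma flat0_eq0 x : x <= 0 -> flat 0 x = 0.
Proof. by move=> x0; rewrite /flat ltNge x0. Qed.

(** The standard smooth transition from 0 to 1 across the unit interval; [1 - x] is written so as to
    match [sm_aff]. *)
Definition sstep x : R := flat 0 x * (flat 0 x + flat 0 (-1 * x + 1))^-1.

Lemma sstep_den_gt0 x : 0 < flat 0 x + flat 0 (-1 * x + 1).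
Proof.
have [x0|x0] := ltP 0 x; first by rewrite ltr_wpDr ?flat_ge0 ?flat0_gt0.
by rewrite ltr_wpDl ?flat_ge0 ?flat0_gt0//; lra.
Qed.

Lemma sm_sstep : sm sstep.
Proof.
apply: sm_mul; first exact: sm_flat.
apply: sm_inv => [|x]; last by rewrite gt_eqF// sstep_den_gt0.
apply: sm_add; first exact: sm_flat.
by apply: sm_aff; exact: sm_flat.
Qed.

Lemma sstep_eq0 x : x <= 0 -> sstep x = 0.
Proof. by move=> x0; rewrite /sstep flat0_eq0// mul0r. Qed.

Lemma sstep_eq1 x : 1 <= x -> sstep x = 1.
Proof.
move=> x1; rewrite /sstep (@flat0_eq0 (-1 * x + 1)) ?addr0; last lra.
by rewrite mulfV// gt_eqF// flat0_gt0//; lra.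
Qed.

Lemma sstep_homo x y : x <= y -> sstep x <= sstep y.
Proof.
move=> xy; rewrite /sstep ler_pdivrMr ?sstep_den_gt0// mulrAC.
rewrite ler_pdivlMr ?sstep_den_gt0//.
(* After clearing denominators and the common product, it remains that [flat 0 x * flat 0 (1 - y)]
   is at most [flat 0 y * flat 0 (1 - x)]. *)
have h1 := flat0_homo xy.
have h2 : flat 0 (-1 * y + 1) <= flat 0 (-1 * x + 1) by apply: flat0_homo; lra.
have := flat_ge0 0 x; have := flat_ge0 0 y.
have := flat_ge0 0 (-1 * y + 1); nra.
Qed.

Lemma sstep_ge0 x : 0 <= sstep x.
Proof.
have [x0|x0] := leP x 0; first by rewrite sstep_eq0.
by rewrite -(@sstep_eq0 0)// sstep_homo// ltW.
Qed.

Lemma sstep_le1 x : sstep x <= 1.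
Proof.
have [x1|x1] := leP 1 x; first by rewrite sstep_eq1.
by rewrite -(@sstep_eq1 1)// sstep_homo// ltW.
Qed.

End SmoothLine.

Section TensorProduct.
Context {R : realType}.
Implicit Types (a b c : R -> R) (x : pt R).

(** Test functions in space are built as products of one-variable functions: a partial derivative
    acts on one factor and keeps this form, so smoothness reduces to the class [sm]. *)
Definition tens a b c : sfield R := fun x => a x.1.1 * b x.1.2 * c x.2.

Let is_derive_cst_pt (k x : R) : is_derive x 1 (fun _ : R => k) 0.
Proof. exact: is_derive_cst. Qed.

Let is_derive_slot (f : R -> R) (F : sfield R) (k t : R) (x v : pt R) : sm f ->
  (forall h : R, F (h *: v + x) = k * f (h *: 1 + t)) ->
  is_derive x v F (k * derive1 f t).
Proof.
move=> sf E; apply/is_derive_lineP; rewrite (funext E).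
have /is_derive_lineP df := sm_is_derive t sf.
apply: is_derive_eq (is_deriveM (is_derive_cst_pt k 0) df) _.
by rewrite [X in _ + X](_ : _ = 0) ?addr0//; exact: mulr0.
Qed.

Lemma ord3P (P : 'I_3 -> Prop) : P 0 -> P 1 -> P 2%:R -> forall i, P i.
Proof.
move=> P0 P1 P2 [[|[|[|//]]] Hi].
- by rewrite (_ : Ordinal Hi = 0)//; exact: val_inj.
- by rewrite (_ : Ordinal Hi = 1)//; exact: val_inj.
- by rewrite (_ : Ordinal Hi = 2%:R)//; exact: val_inj.
Qed.

Lemma partial_tens a b c (i : 'I_3) : sm a -> sm b -> sm c ->
  exists a' b' c', [/\ sm a', sm b', sm c',
    partial i (tens a b c) = tens a' b' c' &
    forall x, derivable (tens a b c) x (ebas i)].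
Proof.
move=> sa sb sc; have sa' := sm_derive1 sa; have sb' := sm_derive1 sb.
have sc' := sm_derive1 sc; move: i; apply: ord3P.
- exists (derive1 a), b, c; have dx x : is_derive x (ebas 0) (tens a b c)
      (b x.1.2 * c x.2 * derive1 a x.1.1).
    apply: is_derive_slot => // h.
    by rewrite /tens /ebas/= /GRing.scale/= !mulr0 !add0r; ring.
  split=> //.
  by apply/funext => x; rewrite /partial; have [_ ->] := dx x; rewrite /tens; ring.
- exists a, (derive1 b), c; have dx x : is_derive x (ebas 1) (tens a b c)
      (a x.1.1 * c x.2 * derive1 b x.1.2).
    apply: is_derive_slot => // h.
    by rewrite /tens /ebas/= /GRing.scale/= !mulr0 !add0r; ring.
  split=> //.
  by apply/funext => x; rewrite /partial; have [_ ->] := dx x; rewrite /tens; ring.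
- exists a, b, (derive1 c); have dx x : is_derive x (ebas 2%:R) (tens a b c)
      (a x.1.1 * b x.1.2 * derive1 c x.2).
    apply: is_derive_slot => // h.
    by rewrite /tens /ebas/= /GRing.scale/= !mulr0 !add0r; ring.
  split=> //.
  by apply/funext => x; rewrite /partial; have [_ ->] := dx x; rewrite /tens; ring.
Qed.

Lemma continuous_tens a b c : sm a -> sm b -> sm c -> continuous (tens a b c).
Proof.
move=> /sm_continuous ca /sm_continuous cb /sm_continuous cc x.
have c1 : y.1.1 @[y --> x] --> x.1.1.
  by apply: (@cvg_comp _ _ _ fst fst); exact: cvg_fst.
have c2 : y.1.2 @[y --> x] --> x.1.2.
  by apply: (@cvg_comp _ _ _ fst snd); [exact: cvg_fst|exact: cvg_snd].
have c3 : y.2 @[y --> x] --> x.2 by exact: cvg_snd.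
by apply: cvgM; [apply: cvgM|];
  [exact: cvg_comp c1 (ca _)|exact: cvg_comp c2 (cb _)|exact: cvg_comp c3 (cc _)].
Qed.

Lemma smooth_tens a b c : sm a -> sm b -> sm c -> smooth (tens a b c).
Proof.
move=> sa sb sc l /=.
have [a' [b' [c' [sa' sb' sc' ->]]]] : exists a' b' c',
    [/\ sm a', sm b', sm c' & foldr partial (tens a b c) l = tens a' b' c'].
  elim: l => /= [|i l [a' [b' [c' [sa' sb' sc' ->]]]]]; first by exists a, b, c.
  have [a'' [b'' [c'' [? ? ? -> _]]]] := partial_tens i sa' sb' sc'.
  by exists a'', b'', c''.
split; first exact: continuous_tens.
by move=> x i; have [? [? [? []]]] := partial_tens i sa' sb' sc'.
Qed.

End TensorProduct.

Section Smooth.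
Context {R : realType}.
Implicit Types (f : sfield R) (x : pt R) (i j : 'I_3).

Lemma smooth_partial i f : smooth f -> smooth (partial i f).
Proof. by move=> sf l; have := sf (rcons l i); rewrite foldr_rcons. Qed.

Lemma smooth_continuous f : smooth f -> continuous f.
Proof. by move=> /(_ [::])[]. Qed.

Lemma smooth_cst (c : R) : smooth (cst c : sfield R).
Proof.
rewrite (_ : cst c = tens (cst c) (cst 1) (cst 1)).
  by apply: smooth_tens; exact: sm_cst.
by apply/funext => x; rewrite /tens /= !mulr1.
Qed.

Lemma test_fun_smooth O f : test_fun O f -> smooth f.
Proof. by case. Qed.

Let is_derive_line i f x (h : R) : smooth f ->
  is_derive h 1 (fun t : R => f (t *: ebas i + x)) (partial i f (h *: ebas i + x)).
Proof.
move=> sf; apply/is_derive_lineP.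
rewrite (_ : (fun _ => _) = fun t : R => f (t *: ebas i + (h *: ebas i + x))).
  apply/is_derive_lineP; apply: DeriveDef => //.
  by have [_] := sf [::]; exact.
by apply/funext => t; rewrite [t *: 1]mulr1 scalerDl addrA.
Qed.

(** The mean value theorem twice: along [ebas i] for the difference in direction [ebas j], then
    along [ebas j] for the derivative so obtained. *)
Let mixed_difference i j f x (s t : R) : smooth f -> 0 < s -> 0 < t ->
  exists h k : R, [/\ 0 <= h <= s, 0 <= k <= t &
    f (s *: ebas i + (t *: ebas j + x)) - f (s *: ebas i + x)
      - (f (t *: ebas j + x) - f x) =
    partial j (partial i f) (k *: ebas j + (h *: ebas i + x)) * t * s].
Proof.
move=> sf s0 t0.
pose phi (h : R) := f (h *: ebas i + (t *: ebas j + x)) - f (h *: ebas i + x).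
have dphi (h : R) : is_derive h 1 phi (partial i f (h *: ebas i + (t *: ebas j + x))
    - partial i f (h *: ebas i + x)).
  by apply: is_deriveB; exact: is_derive_line.
have cphi : {within `[0, s], continuous phi}.
  by apply: derivable_within_continuous => h _; have [] := dphi h.
have [h hs eh] := MVT_segment (ltW s0) (fun h _ => dphi h) cphi.
pose psi (k : R) := partial i f (k *: ebas j + (h *: ebas i + x)).
have dpsi (k : R) : is_derive k 1 psi
    (partial j (partial i f) (k *: ebas j + (h *: ebas i + x))).
  by apply: is_derive_line; exact: smooth_partial.
have cpsi : {within `[0, t], continuous psi}.
  by apply: derivable_within_continuous => k _; have [] := dpsi k.
have [k kt ek] := MVT_segment (ltW t0) (fun k _ => dpsi k) cpsi.
exists h, k; split; [by rewrite in_itv/= in hs|by rewrite in_itv/= in kt|].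
move: eh ek; rewrite /phi /psi !scale0r !add0r !subr0 => ->.
by rewrite addrCA => ->.
Qed.

Let eq_of_difference (a b c d p q r : R) : r != 0 ->
  a - b - (c - d) = p * r * r -> a - c - (b - d) = q * r * r -> p = q.
Proof.
move=> r0 h1 h2; apply: (mulIf r0); apply: (mulIf r0); rewrite -h1 -h2; ring.
Qed.

Let close_to_common (p q a e : R) :
  `|p - a| < e / 2 -> `|q - a| < e / 2 -> `|p - q| <= e.
Proof.
move=> h1 h2; rewrite (le_trans (ler_distD a _ _))// (distrC a) (splitr e).
by rewrite lerD// ltW.
Qed.

(* Clairaut: both iterated derivatives are limits of the same mixed second
   difference quotient. *)
Lemma partialC i j f : smooth f -> partial i (partial j f) = partial j (partial i f).
Proof.
move=> sf; apply/funext => x; apply/eqP; rewrite -subr_eq0 -normr_le0.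
apply/ler_addgt0Pl => e e0; rewrite addr0.
have e20 : 0 < e / 2 by rewrite divr_gt0.
have cont (l m : 'I_3) : nbhs x
    [set y | `|partial l (partial m f) x - partial l (partial m f) y| < e / 2].
  have /(_ x) := smooth_continuous (smooth_partial l (smooth_partial m sf)).
  by move=> /cvgrPdist_lt/(_ _ e20).
have : nbhs x ([set y | `|partial i (partial j f) x - partial i (partial j f) y| < e / 2]
    `&` [set y | `|partial j (partial i f) x - partial j (partial i f) y| < e / 2]).
  by apply: filterI; exact: cont.
rewrite -nbhs_ballE => -[d /= d0 hd].
(* With steps at most [r], the intermediate points of both mixed differences stay in the ball of
   radius [d]. *)
pose r := d / (`|ebas i| + `|ebas j| + 1 : R).
have n0 : 0 < `|ebas i| + `|ebas j| + 1 :> R.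
  by rewrite ltr_wpDl// addr_ge0.
have r0 : 0 < r by rewrite divr_gt0.
have inball (h k : R) : 0 <= h <= r -> 0 <= k <= r ->
    ball x d (h *: ebas i + (k *: ebas j + x)).
  move=> /andP[h0 hr] /andP[k0 kr].
  rewrite -ball_normE /ball_/= addrA opprD addrCA subrr addr0 normrN.
  rewrite (le_lt_trans (ler_normD _ _))// !normrZ (ger0_norm h0) (ger0_norm k0).
  apply: (@le_lt_trans _ _ (r * `|ebas i : pt R| + r * `|ebas j : pt R|)).
    by rewrite lerD// ler_wpM2r.
  by rewrite -mulrDr /r mulrAC ltr_pdivrMr// ltr_pM2l// ltrDl.
have [h1 [k1 [h1r k1r e1]]] := mixed_difference i j x sf r0 r0.
have [h2 [k2 [h2r k2r e2]]] := mixed_difference j i x sf r0 r0.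
have [_ B1] := hd _ (inball _ _ h1r k1r).
have [A2 _] := hd _ (inball _ _ k2r h2r).
rewrite /= addrCA in B1; rewrite /= in A2.
rewrite (addrCA (r *: ebas j)) in e2.
have E := eq_of_difference (lt0r_neq0 r0) e1 e2.
rewrite -E in A2; exact: close_to_common A2 B1.
Qed.

End Smooth.

(** * Octants as a generating class stable under intersection *)

Section Octants.
Context {R : realType}.
Implicit Types (a b c x : pt R).

Definition octant c : set (pt R) :=
  `]c.1.1, +oo[ `*` `]c.1.2, +oo[ `*` `]c.2, +oo[.

Definition ptmax a b : pt R :=
  ((Num.max a.1.1 b.1.1, Num.max a.1.2 b.1.2), Num.max a.2 b.2).

Lemma in_octant c x :
  octant c x <-> [/\ c.1.1 < x.1.1, c.1.2 < x.1.2 & c.2 < x.2].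
Proof.
split=> [[[]]|[h1 h2 h3]]; first by rewrite /= !in_itv/= !andbT.
by split; [split|]; rewrite /= in_itv/= andbT.
Qed.

Lemma octantI a b : octant a `&` octant b = octant (ptmax a b).
Proof.
apply/seteqP; split=> x; rewrite in_octant /= !gt_max.
  by move=> [/in_octant[-> -> ->] /in_octant[-> -> ->]].
by move=> [/andP[? ?] /andP[? ?] /andP[? ?]]; split; apply/in_octant.
Qed.

Lemma octant_obox c a b : octant c `&` obox a b = obox (ptmax c a) b.
Proof.
apply/seteqP; split=> x.
  move=> [/in_octant[h1 h2 h3]] [[/=]]; rewrite !in_itv/=.
  move=> /andP[l1 u1] /andP[l2 u2] /andP[l3 u3].
  by split; [split|]; rewrite /= in_itv/= gt_max ?h1 ?h2 ?h3 ?l1 ?l2 ?l3.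
move=> [[/=]]; rewrite !in_itv/= !gt_max.
move=> /andP[/andP[h1 l1] u1] /andP[/andP[h2 l2] u2] /andP[/andP[h3 l3] u3].
split; first exact/in_octant.
by split; [split|]; rewrite /= in_itv/= ?l1 ?l2 ?l3.
Qed.

(** A coordinate half-space is a countable union of octants whose two other corner coordinates tend
    to minus infinity. Hence the three coordinates, and with them the identity, are measurable for
    the generated sigma-algebra. *)
Lemma measurable_octant :
  (@measurable _ (measurableTypeR R * measurableTypeR R * measurableTypeR R)%type)
  = <<s range octant >>.
Proof.
apply/seteqP; split=> A; last first.
  move=> mA; apply: mA; split; first exact: sigma_algebra_measurable.
  move=> _ [c _ <-]; apply: measurableX; first apply: measurableX;
    exact: measurable_itv.
move=> mA.
have coord (p : pt R -> R) (q : R -> nat -> pt R) :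
    (forall (t : R), p @^-1` `]t, +oo[ = \bigcup_n octant (q t n)) ->
    measurable_fun setT (p : g_sigma_algebraType (range octant) -> measurableTypeR R).
  move=> pq; apply: (measurability _ (RGenOInfty.measurableE R)).
  move=> _ [_ [t ->] <-]; rewrite setTI pq; apply: bigcup_measurable => n _.
  by apply: sub_sigma_algebra; exists (q t n).
have archi (t : R) : exists n : nat, - n%:R < t.
  by exists (Num.truncn `|t|).+1; rewrite ltrNl (le_lt_trans (ler_norm _))// normrN truncnS_gt.
have maxn2 (s t : R) : exists n : nat, - n%:R < s /\ - n%:R < t.
  have [n hn] := archi s; have [m hm] := archi t; exists (maxn n m).
  by split; [apply: le_lt_trans hn|apply: le_lt_trans hm];
    rewrite lerN2 ler_nat ?leq_maxl ?leq_maxr.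
have m1 := coord (fun x => x.1.1) (fun t n => ((t, - n%:R), - n%:R)).
have m2 := coord (fun x => x.1.2) (fun t n => ((- n%:R, t), - n%:R)).
have m3 := coord (fun x => x.2) (fun t n => ((- n%:R, - n%:R), t)).
have /(_ measurableT _ mA) : measurable_fun setT
    (id : g_sigma_algebraType (range octant) -> pt R).
  apply/measurable_fun_pairP; split; first apply/measurable_fun_pairP; first split.
  - apply: m1 => t; apply/seteqP; split=> x /=; rewrite in_itv/= andbT.
      by have [n [h1 h2]] := maxn2 x.1.2 x.2; exists n => //; apply/in_octant.
    by move=> [n _ /in_octant[]].
  - apply: m2 => t; apply/seteqP; split=> x /=; rewrite in_itv/= andbT.
      by have [n [h1 h2]] := maxn2 x.1.1 x.2; exists n => //; apply/in_octant.
    by move=> [n _ /in_octant[]].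
  - apply: m3 => t; apply/seteqP; split=> x /=; rewrite in_itv/= andbT.
      by have [n [h1 h2]] := maxn2 x.1.1 x.1.2; exists n => //; apply/in_octant.
    by move=> [n _ /in_octant[]].
by rewrite setTI preimage_id.
Qed.

End Octants.

Section BoundedOpen.
Context {R : realType} (O : set (pt R)) (oO : open O) (bO : bounded_set O).
Implicit Types (f g : sfield R) (a b x : pt R).

Let mO : measurable O. Proof. exact: open_pt_measurable. Qed.

(** [f] is continuous on the whole space, hence bounded on a compact box that contains [O]. *)
Lemma bounded_continuous f : continuous f -> exists M : R, forall x, O x -> `|f x| <= M.
Proof.
move=> cf; have [N hN] : exists N : R, forall x, O x -> `|x| <= N.
  case: bO => M [Mr hM]; exists (`|M| + 1) => x Ox; apply: hM => //.
  by rewrite (le_lt_trans (ler_norm _)) ?ltrDl.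
pose K := cbox ((- N, - N), - N) ((N, N), N).
have /compact_bounded[M [Mr hM]] : compact (f @` K).
  by apply: continuous_compact; [exact: continuous_subspaceT|exact: compact_cbox].
exists (`|M| + 1) => x Ox; apply: (hM _ _ (f x)).
  by rewrite (le_lt_trans (ler_norm _)) ?ltrDl.
exists x => //; move: (hN x Ox); rewrite !ge_max => /andP[/andP[h1 h2] h3].
by split; [split|]; rewrite /= in_itv/= -ler_norml.
Qed.

Lemma L2_continuous f : continuous f -> L2 O f.
Proof.
move=> cf; split; first exact: continuous_measurable_pt.
have [M hM] := bounded_continuous cf.
apply: (@le_lt_trans _ _ (\int[leb3]_(x in O) (cst (M ^+ 2)%:E x))%E).
  apply: ge0_le_integral_any => x Ox; rewrite lee_fin ?sqr_ge0//.
  by rewrite -real_normK ?num_real// lerXn2r ?nnegrE ?hM// (le_trans _ (hM x Ox)).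
by rewrite integral_cst// lte_mul_pinfty ?lee_fin ?sqr_ge0//; exact: bounded_leb3_finite.
Qed.

Lemma L2_smooth f : smooth f -> L2 O f.
Proof. by move=> /smooth_continuous; exact: L2_continuous. Qed.

Lemma vL2_cgrad f : smooth f -> vL2 O (cgrad f).
Proof. by move=> sf i; apply: L2_smooth; exact: smooth_partial. Qed.

Lemma L2_integrable f : L2 O f -> leb3.-integrable O (EFin \o f).
Proof.
move=> Lf; have L1 : L2 O (cst 1) by apply: L2_continuous => x; exact: cvg_cst.
by apply: eq_integrable (L2_ip_def mO Lf L1) => // x _; rewrite /= mulr1.
Qed.

End BoundedOpen.

(** * The fundamental lemma of the calculus of variations *)

Section FundamentalLemma.
Context {R : realType}.
Implicit Types (s t r : R) (n : nat) (a b x : pt R) (f g : sfield R).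

(* A smooth function supported in [s, t] that increases with [n] to the
   indicator function of the open interval, since [flat 0 y = exp (- 1 / y)]. *)
Definition bump n s t r : R :=
  flat 0 (n.+1%:R * r + - (n.+1%:R * s)) * flat 0 (- n.+1%:R * r + n.+1%:R * t).

Lemma sm_bump n s t : sm (bump n s t).
Proof.
by apply: sm_mul; apply: (@sm_aff _ (flat 0)); exact: sm_flat.
Qed.

Lemma flat0_le1 r : flat 0 r <= 1.
Proof. exact: flat_le. Qed.

Lemma bump_ge0 n s t r : 0 <= bump n s t r.
Proof. by rewrite mulr_ge0 ?flat_ge0. Qed.

Lemma bump_le1 n s t r : bump n s t r <= 1.
Proof. by rewrite mulr_ile1 ?flat_ge0 ?flat0_le1. Qed.

Lemma bump_out n s t r : r \notin `]s, t[ -> bump n s t r = 0.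
Proof.
rewrite in_itv/= negb_and -!leNgt => /orP[h|h]; rewrite /bump.
  by rewrite flat0_eq0 ?mul0r// -mulrBr pmulr_rle0// subr_le0.
by rewrite [X in _ * X]flat0_eq0 ?mulr0// mulNr addrC -mulrBr pmulr_rle0// subr_le0.
Qed.

Lemma cvg_flat0 (d : R) : 0 < d -> flat 0 (n.+1%:R * d) @[n --> \oo] --> (1 : R).
Proof.
move=> d0; have E n : flat 0 (n.+1%:R * d) = expR (- (d^-1 * harmonic n)).
  by rewrite /flat mulr_gt0// expr0 mul1r /harmonic/= invfM mulrC.
rewrite (funext E) -[X in _ --> X]expR0 -[X in expR X]oppr0 -(mulr0 d^-1).
apply: continuous_cvg; first exact: continuous_expR.
by apply: cvgN; apply: cvgMr; exact: cvg_harmonic.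
Qed.

Lemma cvg_bump s t r : bump n s t r @[n --> \oo] --> (\1_(`]s, t[%classic) r : R).
Proof.
rewrite indicE; have [/set_mem|/negP h] := boolP (r \in `]s, t[%classic); last first.
  rewrite /=; apply: cvg_near_cst; apply: nearW => n; apply: bump_out.
  by apply/negP => h'; apply: h; rewrite inE.
rewrite /= in_itv/= => /andP[sr rt].
rewrite -[1%:R](mulr1 (1 : R)); apply: cvgM.
  under eq_fun do rewrite -mulrBr.
  by apply: cvg_flat0; rewrite subr_gt0.
under eq_fun do rewrite mulNr addrC -mulrBr.
by apply: cvg_flat0; rewrite subr_gt0.
Qed.

Definition bump3 n a b : sfield R :=
  tens (bump n a.1.1 b.1.1) (bump n a.1.2 b.1.2) (bump n a.2 b.2).

Lemma bump3_out n a b x : ~ obox a b x -> bump3 n a b x = 0.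
Proof.
move=> nx; rewrite /bump3 /tens.
have [h1|h1] := boolP (x.1.1 \in `]a.1.1, b.1.1[); last by rewrite bump_out ?mul0r.
have [h2|h2] := boolP (x.1.2 \in `]a.1.2, b.1.2[).
  have [h3|h3] := boolP (x.2 \in `]a.2, b.2[); last first.
    by rewrite [X in _ * X]bump_out ?mulr0.
  by exfalso; apply: nx; split; [split|].
by rewrite [X in _ * X * _]bump_out ?mulr0 ?mul0r.
Qed.

Lemma test_fun_bump3 O n a b : cbox a b `<=` O -> test_fun O (bump3 n a b).
Proof.
move=> abO; split; first by apply: smooth_tens; exact: sm_bump.
exists (cbox a b); split => //; first exact: compact_cbox.
by move=> x nx; apply: bump3_out => /obox_cbox.
Qed.

Lemma cvg_bump3 a b x : bump3 n a b x @[n --> \oo] --> (\1_(obox a b) x : R).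
Proof.
have -> : \1_(obox a b) x = \1_(`]a.1.1, b.1.1[%classic) x.1.1 *
    \1_(`]a.1.2, b.1.2[%classic) x.1.2 * \1_(`]a.2, b.2[%classic) x.2 :> R.
  by rewrite !indicE /obox !in_setX -!natrM !mulnb.
by apply: cvgM; first apply: cvgM; exact: cvg_bump.
Qed.

Lemma bump3_le1 n a b x : `|bump3 n a b x| <= 1.
Proof.
rewrite /bump3 /tens ger0_norm.
  by rewrite mulr_ile1 ?bump_ge0 ?bump_le1//;
    [rewrite mulr_ge0 ?bump_ge0|rewrite mulr_ile1 ?bump_ge0 ?bump_le1].
by apply: mulr_ge0; [apply: mulr_ge0|]; exact: bump_ge0.
Qed.

Variables (O : set (pt R)) (oO : open O) (bO : bounded_set O).

Let mO : measurable O. Proof. exact: open_pt_measurable. Qed.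

Variable g : sfield R.
Hypotheses (Lg : L2 O g) (g0 : forall phi, test_fun O phi -> ip O g phi = 0).

Let Ig := L2_integrable oO bO Lg.

(** Dominated convergence along the test functions [bump3 n a b], with [g] itself as majorant. *)
Let integral_obox a b : cbox a b `<=` O ->
  (\int[leb3]_(x in obox a b) (g x)%:E = 0)%E.
Proof.
move=> abO.
have abO' : obox a b `<=` O by move=> x /obox_cbox; exact: abO.
have : (\int[leb3]_(x in O) (g x * bump3 n a b x)%:E)%E @[n --> \oo]
    --> (\int[leb3]_(x in O) (g x * \1_(obox a b) x)%:E)%E.
  apply: (@dominated_cvg _ _ _ _ _ mO _ _ (fun x => `|(g x)%:E|%E)) => //.
  - move=> n; apply/measurable_EFinP; apply: measurable_funM; first by case: Lg.
    apply: continuous_measurable_pt => //.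
    by apply: smooth_continuous; apply: smooth_tens; exact: sm_bump.
  - move=> x _; apply: cvg_EFin; first exact: nearW.
    by apply: cvgMr; exact: cvg_bump3.
  - exact: integrable_abse.
  - move=> n x _; rewrite /= lee_fin normrM.
    by rewrite ler_piMr// bump3_le1.
rewrite (_ : (fun _ => _) = cst 0%E); last first.
  apply/funext => n /=; have tb := test_fun_bump3 n abO.
  have := g0 tb; rewrite /ip /Rintegral => h.
  rewrite -[LHS]fineK ?h//; apply: integrable_fin_num => //.
  by apply: (L2_ip_def mO Lg); apply: (L2_smooth oO bO); exact: test_fun_smooth tb.
move=> /(cvg_lim (@ereal_hausdorff R)); rewrite lim_cst// => E.
rewrite [RHS]E -[in LHS](setIidr abO') integral_mkcondr.
apply: eq_integral => x _; rewrite /patch indicE.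
by case: ifP; rewrite /= ?mulr1 ?mulr0.
Qed.

(** Dynkin's argument inside a fixed box, where [g] is integrable: the generators cause no trouble
    because an octant meets the box in a smaller box. *)
Let integral_sub_obox a b (E : set (pt R)) : cbox a b `<=` O -> measurable E ->
  (\int[leb3]_(x in E `&` obox a b) (g x)%:E = 0)%E.
Proof.
move=> abO mE; have mB := measurable_obox a b.
have abO' : obox a b `<=` O by move=> x /obox_cbox; exact: abO.
have IgS S : measurable S -> S `<=` obox a b -> leb3.-integrable S (EFin \o g).
  by move=> mS SB; apply: (integrableS mO) => // x /SB; exact: abO'.
have mgS S : measurable S -> S `<=` obox a b -> measurable_fun S (EFin \o g).
  by move=> mS SB; apply: measurable_int; exact: IgS.
have : <<s range (@octant R) >> E by rewrite -measurable_octant.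
move: E {mE}; apply: (@dynkin_induction _ _ (range (@octant R))
  (fun E => (\int[leb3]_(x in E `&` obox a b) (g x)%:E = 0)%E)).
- exact: measurable_octant.
- by move=> _ _ [c _ <-] [d _ <-]; rewrite octantI; exists (ptmax c d).
- by rewrite setTI integral_obox.
- move=> _ [c _ <-]; rewrite octant_obox integral_obox// => x [[h1 h2] h3]; apply: abO.
  move: h1 h2 h3; rewrite /= !in_itv/= !ge_max.
  move=> /andP[/andP[_ l1] u1] /andP[/andP[_ l2] u2] /andP[/andP[_ l3] u3].
  by split; [split|]; rewrite /= in_itv/= ?l1 ?l2 ?l3.
- move=> S mS S0; have mSB := measurableI _ _ mS mB.
  have mCSB := measurableI _ _ (measurableC mS) mB.
  have := integral_obox abO.
  have -> : obox a b = (S `&` obox a b) `|` (~` S `&` obox a b).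
    by rewrite -setIUl setUv setTI.
  rewrite integral_setU//; first by rewrite S0 add0e -setIUl setUv setTI.
    by rewrite -setIUl setUv setTI; exact: mgS.
  by rewrite disj_set2E setIACA setICr set0I.
- move=> F mF tF F0; rewrite setI_bigcupl integral_bigcup.
  + by rewrite eseries0.
  + exact: trivIset_setIr.
  + by move=> k; exact: measurableI.
  + by apply: IgS; [apply: bigcup_measurable => k _; exact: measurableI|move=> x [k _ []]].
Qed.

(** On each rational box with closure in [O], [g] integrates to 0 over every measurable part and so
    vanishes almost everywhere; countably many such boxes cover [O]. *)
Lemma ip_test_eq0 : {ae leb3, forall x, O x -> g x = 0}.
Proof.
pose P (k : (rat * rat * rat) * (rat * rat * rat)) x :=
  cbox (ratpt k.1) (ratpt k.2) `<=` O -> obox (ratpt k.1) (ratpt k.2) x -> g x = 0.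
have aeP k : {ae leb3, forall x, P k x}.
  have [kO|nkO] := pselect (cbox (ratpt k.1) (ratpt k.2) `<=` O); last first.
    by apply: aeW => x /nkO.
  have mB := @measurable_obox R (ratpt k.1) (ratpt k.2).
  have BO : obox (ratpt k.1) (ratpt k.2) `<=` O by move=> x /obox_cbox; exact: kO.
  have := @integral_ae_eq _ _ _ leb3 _ mB (cst 0%E) (EFin \o g)
    (integrableS mO mB BO Ig) (measurable_cst _).
  have E0 E : E `<=` obox (ratpt k.1) (ratpt k.2) -> measurable E ->
      (\int[leb3]_(x in E) (EFin \o g) x = \int[leb3]_(x in E) cst 0 x)%E.
    by move=> EB mE; rewrite integral0 -{1}(setIidl EB) integral_sub_obox.
  move=> /(_ E0).
  by apply: filterS => x gx _ Bx; have [->] := gx Bx.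
(* Numbering the pairs of rational corners by [pickle] puts the countable union of null sets in the
   form of [ae_foralln]. *)
have ae n : {ae leb3, forall x, if unpickle n is Some k then P k x else True}.
  by case: (unpickle n) => [k|]; [exact: aeP|exact: aeW].
apply: filterS (ae_foralln ae) => x Px Ox.
have [p [q [h1 h2]]] := rat_box oO Ox.
by have := Px (pickle (p, q)); rewrite pickleK; apply.
Qed.

End FundamentalLemma.

(** * Weak divergence and curl *)

Section WeakDerivatives.
Context {R : realType} (O : set (pt R)) (oO : open O) (bO : bounded_set O).
Implicit Types (f g h : sfield R) (v w z : vfield R) (a : R).

Let mO : measurable O. Proof. exact: open_pt_measurable. Qed.

Lemma eq_ip_ae f g h : {ae leb3, forall x, O x -> f x = g x} -> ip O f h = ip O g h.
Proof.
move=> [A [mA A0 fgA]]; apply: (eq_Rintegral_off mA A0) => x Ox nAx.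
suff -> : f x = g x by [].
by apply: contrapT => fgx; apply: nAx; apply: fgA => /= /(_ Ox).
Qed.

(** Every computation with [wdiv], whose value is an arbitrary choice, goes through this uniqueness;
    this is why linearity of [wdiv] holds only almost everywhere. *)
Lemma L2_wdiv_unique v g1 g2 : is_wdiv O v g1 -> is_wdiv O v g2 ->
  {ae leb3, forall x, O x -> g1 x = g2 x}.
Proof.
move=> [L1 h1] [L2g h2].
have S := ip_semi_ip mO.
have : {ae leb3, forall x, O x -> (g1 - g2) x = 0}.
  apply: (ip_test_eq0 oO bO); first exact: (sipXB S).
  move=> phi tphi; have Lphi := L2_smooth oO bO (test_fun_smooth tphi).
  rewrite (sipBl S)//; have := h1 _ tphi; rewrite h2// => /eqP.
  by rewrite eqr_opp => /eqP ->; rewrite subrr.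
by apply: filterS => x gx Ox; apply/eqP; rewrite -subr_eq0; apply/eqP; exact: gx.
Qed.

Lemma wdivP v : Hdiv O v -> is_wdiv O v (wdiv O v).
Proof. by move=> [_ [g vg]]; apply: (@getPex _ [set g | is_wdiv O v g]); exists g. Qed.

Lemma L2_wdiv v : Hdiv O v -> L2 O (wdiv O v).
Proof. by move=> /wdivP[]. Qed.

Lemma wcurlP v : Hcurl O v -> is_wcurl O v (wcurl O v).
Proof. by move=> [_ [g vg]]; apply: (@getPex _ [set g | is_wcurl O v g]); exists g. Qed.

Lemma is_wdiv_lin a v w gv gw : vL2 O v -> vL2 O w ->
  is_wdiv O v gv -> is_wdiv O w gw -> is_wdiv O (a *: v + w) (a *: gv + gw).
Proof.
move=> Lv Lw [Lgv hv] [Lgw hw]; split; first exact: L2_lin.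
move=> phi tphi; have sphi := test_fun_smooth tphi.
rewrite vip_lin//; last exact: vL2_cgrad.
by rewrite ip_lin//; [rewrite hv// hw// mulrN opprD|exact: L2_smooth].
Qed.

Lemma Hdiv_lin a v w : Hdiv O v -> Hdiv O w -> Hdiv O (a *: v + w).
Proof.
move=> Hv Hw; have [[Lv _] [Lw _]] := (Hv, Hw); split; first exact: vL2_lin.
by exists (a *: wdiv O v + wdiv O w); apply: is_wdiv_lin => //; exact: wdivP.
Qed.

Lemma wdiv_lin a v w : Hdiv O v -> Hdiv O w ->
  {ae leb3, forall x, O x -> wdiv O (a *: v + w) x = (a *: wdiv O v + wdiv O w) x}.
Proof.
move=> Hv Hw; have [[Lv _] [Lw _]] := (Hv, Hw); apply: L2_wdiv_unique.
  by apply: wdivP; exact: Hdiv_lin.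
by apply: is_wdiv_lin => //; exact: wdivP.
Qed.

Lemma hdivsqE v : Hdiv O v ->
  hdivsq O v = (vip O v v + ip O (wdiv O v) (wdiv O v))%:E.
Proof.
by move=> Hv; have [Lv _] := Hv; rewrite /hdivsq vnsqE// nsqE//; exact: L2_wdiv.
Qed.

(** Splits [wdiv] of a difference, so that continuity in time for the H(div) norm yields continuity
    of the divergences. *)
Lemma hdivsqB v w : Hdiv O v -> Hdiv O w ->
  hdivsq O (v - w) = (vip O (v - w) (v - w) +
    ip O (wdiv O v - wdiv O w) (wdiv O v - wdiv O w))%:E.
Proof.
move=> Hv Hw; have -> : v - w = (-1) *: w + v by rewrite scaleN1r addrC.
rewrite hdivsqE; last exact: Hdiv_lin.
have E := wdiv_lin (-1) Hw Hv.
rewrite (eq_ip_ae _ E) ipC (eq_ip_ae _ E).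
by rewrite (_ : wdiv O v - _ = -1 *: wdiv O w + wdiv O v)// scaleN1r addrC.
Qed.

Lemma vip0r v : vip O v 0 = 0.
Proof.
rewrite /vip; under eq_Rintegral => x _.
  rewrite /dot big1; last by move=> i _; rewrite mulr0.
  over.
by rewrite Rintegral_cst// mul0r.
Qed.

Lemma cgrad_cst (c : R) : cgrad (cst c : sfield R) = 0.
Proof.
by apply/funext => i; apply/funext => x; rewrite /cgrad /partial derive_val.
Qed.

(** The zero normal trace tested with the constant 1 says that the divergence has mean zero. This
    makes div m an admissible test function in the magnetostatic equation. *)
Lemma spW_wdiv v : spV O v -> spW O (wdiv O v).
Proof.
move=> [Hv tv]; split; first exact: L2_wdiv.
have := tv _ (smooth_cst 1); rewrite cgrad_cst vip0r add0r => <-.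
by apply: eq_Rintegral => x _; rewrite mulr1.
Qed.

Lemma ccurl_cgrad f : smooth f -> ccurl (cgrad f) = 0.
Proof.
move=> sf; apply/funext => i; apply/funext => x.
by rewrite /ccurl /cgrad partialC// subrr.
Qed.

(** Test the zero tangential trace with the gradient of [f], whose curl vanishes by [partialC]. Both
    the zero divergence and the zero normal trace of [wcurl O z] come from this. *)
Lemma vip_wcurl_cgrad z f : spU O z -> smooth f -> vip O (wcurl O z) (cgrad f) = 0.
Proof.
move=> [Hz tz] sf; have sg i : smooth (cgrad f i) by exact: smooth_partial.
by have := tz _ sg; rewrite ccurl_cgrad// vip0r sub0r => /eqP; rewrite oppr_eq0 => /eqP.
Qed.

Lemma is_wdiv_wcurl z : spU O z -> is_wdiv O (wcurl O z) 0.
Proof.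
move=> Uz; split; first exact: L2_0.
move=> phi tphi; rewrite vip_wcurl_cgrad//; last exact: test_fun_smooth tphi.
rewrite (sip0l (ip_semi_ip mO)) ?oppr0//.
by apply: L2_smooth => //; exact: test_fun_smooth tphi.
Qed.

Lemma Hdiv_wcurl z : spU O z -> Hdiv O (wcurl O z).
Proof.
move=> Uz; split; first by have [Hz _] := Uz; have [] := wcurlP Hz.
by exists 0; exact: is_wdiv_wcurl.
Qed.

Lemma ip_wdiv_wcurl z f : spU O z -> L2 O f -> ip O (wdiv O (wcurl O z)) f = 0.
Proof.
move=> Uz Lf; rewrite (@eq_ip_ae _ 0) ?(sip0l (ip_semi_ip mO))//.
apply: L2_wdiv_unique (is_wdiv_wcurl Uz).
by apply: wdivP; exact: Hdiv_wcurl.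
Qed.

Lemma spV_wcurl z : spU O z -> spV O (wcurl O z).
Proof.
move=> Uz; split; first exact: Hdiv_wcurl.
by move=> f sf; rewrite vip_wcurl_cgrad// ip_wdiv_wcurl ?add0r//; exact: L2_smooth.
Qed.

Lemma L2_wpartial i f : H1 O f -> L2 O (wpartial O i f).
Proof.
move=> [_ /(_ i)[g fg]].
have : exists g, is_wpartial O i f g by exists g.
by move=> /(@getPex _ [set g | is_wpartial O i f g])[].
Qed.

End WeakDerivatives.

(** * Pointwise identities for cross products *)

Section Cross.
Context {R : realType}.
Implicit Types (u v w m k H : vfield R) (x : pt R).

Lemma dotE v w x : dot v w x = v 0 x * w 0 x + v 1 x * w 1 x + v 2%:R x * w 2%:R x.
Proof.
rewrite /dot !big_ord_recl big_ord0 addr0 addrA.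
rewrite (_ : lift ord0 ord0 = 1 :> 'I_3)//; last exact: val_inj.
by rewrite (_ : lift ord0 (lift ord0 ord0) = 2%:R :> 'I_3)//; exact: val_inj.
Qed.

Let ord3_sums : ((1 + 1 = 2%:R :> 'I_3)%R * (1 + 2%:R = 0 :> 'I_3)%R *
  (2%:R + 1 = 0 :> 'I_3)%R * (2%:R + 2%:R = 1 :> 'I_3)%R)%type.
Proof. by do !split; exact: val_inj. Qed.

Let crossE v w x : (cross v w 0 x = v 1 x * w 2%:R x - v 2%:R x * w 1 x) *
  (cross v w 1 x = v 2%:R x * w 0 x - v 0 x * w 2%:R x) *
  (cross v w 2%:R x = v 0 x * w 1 x - v 1 x * w 0 x).
Proof. by rewrite /cross !add0r !ord3_sums. Qed.

Lemma dot_cross_self v w x : dot (cross v w) v x = 0.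
Proof. by rewrite dotE !crossE; ring. Qed.

Lemma dot_crossAC u v w x : dot (cross u v) w x = - dot (cross u w) v x.
Proof. by rewrite !dotE !crossE; ring. Qed.

Lemma dot_cross_cross m H x :
  dot (cross m (cross m H)) H x = - dot (cross m H) (cross m H) x.
Proof. exact: dot_crossAC. Qed.

End Cross.

(* [lra] is slow when it has to compare pairings up to conversion. *)
Ltac pairing_lra := repeat match goal with
  | h : context [vip _ _ _] |- _ => clear h
  | h : context [ip _ _ _] |- _ => clear h
  end; repeat match goal with
  | |- context [vip ?O ?v ?w] => move: (vip O v w) => ?
  | |- context [ip ?O ?f ?g] => move: (ip O f g) => ?
  | |- context [tip ?O ?f ?g] => move: (tip O f g) => ?
  | |- context [b_form ?O ?v ?m ?F] => move: (b_form O v m F) => ?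
  end; lra.

(** * The energy identity at one instant *)

Section EnergyIdentity.
Context {R : realType} (O : set (pt R)) (oO : open O) (bO : bounded_set O).
Implicit Types (u ut m mt z k H He v w : vfield R) (p phi f : sfield R).

Let mO : measurable O. Proof. exact: open_pt_measurable. Qed.

Lemma spS_vL2 v : spS O v -> vL2 O v.
Proof. by move=> Sv i; have [[]] := Sv i. Qed.

Lemma spV_vL2 v : spV O v -> vL2 O v.
Proof. by move=> [[]]. Qed.

Lemma spU_vL2 v : spU O v -> vL2 O v.
Proof. by move=> [[]]. Qed.

Lemma spS_wgrad v i j : spS O v -> L2 O (wgrad O v i j).
Proof. by move=> Sv; apply: L2_wpartial; have [] := Sv i. Qed.

Lemma tnsqE v : spS O v -> tnsq O (wgrad O v) = (tip O (wgrad O v) (wgrad O v))%:E.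
Proof.
move=> Sv; set G := wgrad O v.
have If : leb3.-integrable O (fun x => (\sum_i \sum_j G i j x * G i j x)%:E).
  apply: (eq_integrable mO (fun x => \sum_i \sum_j (G i j x * G i j x)%:E)%E).
    by move=> x _; rewrite -sumEFin; apply: eq_bigr => i _; rewrite sumEFin.
  apply: integrable_sum => // i _; apply: integrable_sum => // j _.
  by apply: L2_ip_def => //; exact: spS_wgrad.
rewrite /tip /Rintegral fineK; last exact: integrable_fin_num.
by apply: eq_integral => x _; congr EFin; apply: eq_bigr => i _.
Qed.

Lemma vip_eq0 v w : (forall x, dot v w x = 0) -> vip O v w = 0.
Proof.
move=> vw0; rewrite /vip; under eq_Rintegral => x _ do rewrite vw0.
by rewrite Rintegral_cst// mul0r.
Qed.

Lemma vip_opp v w v' w' : vip_def O v' w' ->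
  (forall x, dot v w x = - dot v' w' x) -> vip O v w = - vip O v' w'.
Proof.
move=> def vw; rewrite -mulN1r /vip -RintegralZl//.
by apply: eq_Rintegral => x _; rewrite vw mulN1r.
Qed.

Lemma vip_def_opp v w v' w' : vip_def O v' w' ->
  (forall x, dot v w x = - dot v' w' x) -> vip_def O v w.
Proof.
move=> def vw; have := integrableN def; apply: eq_integrable => // x _.
by rewrite vw EFinN.
Qed.

Lemma b_form_alt v m F : b_form O v m F = - b_form O v F m.
Proof. by rewrite /b_form opprB. Qed.

Variables (eta mu0 sigma tau chi0 beta : R).

Variables (u ut m mt z k H He : vfield R) (p phi : sfield R).
Hypothesis WP : WP_at O eta mu0 sigma tau chi0 beta u ut p m mt z k H phi He.
Hypotheses (Su : spS O u) (Vm : spV O m) (Uz : spU O z) (Uk : spU O k).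
Hypotheses (VH : spV O H) (VHe : spV O He) (Wp : spW O p)
  (Wphi : spW O phi).

(** Square integrability of m x H does not follow from m and H being in L^2; it comes from the
    integrability that the magnetization equation asserts for the test function [H]. *)
Lemma vip_def_cross : vip_def O (cross m H) (cross m H).
Proof.
have [_ _ def] := WP_magnetization_def WP VH.
by apply: vip_def_opp def _ => x; rewrite dot_cross_cross opprK.
Qed.

(** The coupling terms are brought, by antisymmetry of [b_form] and of the triple product, to the
    form in which they occur in [test_field]. The convective term is orthogonal to [u], and the
    pressure meets a divergence-free field. *)
Lemma test_velocity : vip O ut u + eta * tip O (wgrad O u) (wgrad O u)
  + mu0 * (b_form O u m H + vip O (cross u H) k / 2) = 0.
Proof.
have [_ _ defk] := WP_momentum_def WP Su.
have := WP_momentum WP Su.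
rewrite (vip_eq0 (dot_cross_self _ _)) ipC (WP_incompressible WP Wp).
rewrite (b_form_alt u H m).
have -> : vip O (cross u H) k = - vip O (cross u k) H.
  by apply: vip_opp => // x; exact: dot_crossAC.
by pairing_lra.
Qed.

Lemma test_magnetization : vip O mt m + sigma * vip O k k
  + sigma * ip O (wdiv O m) (wdiv O m) + tau^-1 * vip O m m
  - chi0 / tau * vip O H m = 0.
Proof.
have := WP_magnetization WP Vm.
have -> : b_form O u m m = 0.
  by have := b_form_alt u m m; pairing_lra.
have -> : vip O (cross m (cross m H)) m = 0.
  by apply: vip_eq0 => x; exact: dot_cross_self.
(* Testing crosswise gives [(curl z, m) = (k, z) = (u x m, k)], so the two terms with factor one
   half cancel; [k] tested with itself turns [(curl k, m)] into [(k, k)]. *)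
have hz := WP_z WP Uk; have hkz := WP_k WP Uz; have hkk := WP_k WP Uk.
rewrite vipC in hkz; rewrite (vipC _ (wcurl O z) m) (vipC _ (wcurl O k) m).
by rewrite -(subr0_eq hkk) -(subr0_eq hkz) -(subr0_eq hz); pairing_lra.
Qed.

Lemma test_field : vip O mt H + b_form O u m H + vip O (cross u H) k / 2
  + sigma * ip O (wdiv O m) (wdiv O H) + tau^-1 * vip O m H
  - chi0 / tau * vip O H H - beta * vip O (cross m H) (cross m H) = 0.
Proof.
have := WP_magnetization WP VH.
have -> : vip O (cross m (cross m H)) H = - vip O (cross m H) (cross m H).
  by apply: vip_opp => [|x]; [exact: vip_def_cross|exact: dot_cross_cross].
have [Lphi _] := Wphi.
(* A curl is an admissible test function for the equation of [H], and its zero divergence removes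
   [phi]. *)
have curl0 w : spU O w -> vip O (wcurl O w) H = 0.
  move=> Uw; rewrite vipC; have := WP_H WP (spV_wcurl oO bO Uw).
  by rewrite ipC (ip_wdiv_wcurl oO bO)// addr0.
rewrite !curl0//.
by pairing_lra.
Qed.

Lemma field_pairing w : spV O w -> vip O H w = - ip O (wdiv O w) phi.
Proof. by move=> Vw; have := WP_H WP Vw; rewrite (ipC _ phi); pairing_lra. Qed.

Lemma wdiv_balance f : spW O f ->
  ip O (wdiv O H) f + ip O (wdiv O m) f + ip O (wdiv O He) f = 0.
Proof.
move=> [Lf If]; have := WP_magnetostatic WP (conj Lf If).
have S := ip_semi_ip mO.
by rewrite (sipDl S)//; apply: L2_wdiv; [case: VH|case: Vm].
Qed.

Lemma dissipation_identity :
  eta * tip O (wgrad O u) (wgrad O u)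
  + sigma * (1 + mu0) * ip O (wdiv O m) (wdiv O m) + sigma * vip O k k
  + tau^-1 * vip O m m
  + tau^-1 * (mu0 * (1 + chi0) + chi0) * vip O H H
  + mu0 * beta * vip O (cross m H) (cross m H) =
  - vip O ut u - vip O mt m + mu0 * vip O mt H
  - mu0 * sigma * ip O (wdiv O He) (wdiv O m)
  - (mu0 + chi0) / tau * vip O H He.
Proof.
(* The test function div m eliminates div H from its pairing with div m; the test function [phi]
   yields [(H, H + m + He) = 0], which eliminates [(H, m)]. *)
have h4 := wdiv_balance (spW_wdiv oO Vm).
have h5 := wdiv_balance Wphi.
have h6 := field_pairing VH; have h7 := field_pairing Vm; have h8 := field_pairing VHe.
have h9 : vip O H m = - vip O H H - vip O H He.
  by move: h5 h6 h7 h8; pairing_lra.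
have {}h4 : ip O (wdiv O m) (wdiv O H) =
  - ip O (wdiv O m) (wdiv O m) - ip O (wdiv O He) (wdiv O m).
  by move: h4; rewrite (ipC _ (wdiv O H)); pairing_lra.
(* The claim is [test_velocity] plus [test_magnetization] minus [mu0] times [test_field]. The
   contributions to |H|^2 are [mu0 / tau] and [mu0 * chi0 / tau] from the field and [chi0 / tau]
   from the magnetization. *)
have h1 := test_velocity; have h2 := test_magnetization; have h3 := test_field.
rewrite (vipC _ m H) h9 h4 in h3; rewrite h9 in h2.
have := congr1 (fun r => mu0 * r) h3; rewrite mulr0.
by move: h1 h2; pairing_lra.
Qed.

Lemma dissipationE : dissipation O eta mu0 sigma tau chi0 beta u m k H =
  (2 * (eta * tip O (wgrad O u) (wgrad O u)
  + sigma * (1 + mu0) * ip O (wdiv O m) (wdiv O m) + sigma * vip O k k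
  + tau^-1 * vip O m m
  + tau^-1 * (mu0 * (1 + chi0) + chi0) * vip O H H
  + mu0 * beta * vip O (cross m H) (cross m H)))%:E.
Proof.
have E : vnsq O (cross m H) = (vip O (cross m H) (cross m H))%:E.
  by rewrite /vip /Rintegral fineK//; exact: integrable_fin_num vip_def_cross.
rewrite /dissipation E tnsqE// nsqE//; last by apply: L2_wdiv; case: Vm.
rewrite (vnsqE mO (spU_vL2 Uk)) (vnsqE mO (spV_vL2 Vm)) (vnsqE mO (spV_vL2 VH)).
by [].
Qed.

End EnergyIdentity.

(** * Calculus in time *)

Section RealInduction.
Context {R : realType}.
Implicit Types (g Phi I : R -> R) (a b s t e : R).

(** Real induction: the supremum [c] of the set [A] belongs to [A] by the local hypothesis to the
    left of [c], and if [c < b] the one to the right would extend [A] beyond [c]. *)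
Lemma locally_ndecr a b g : a <= b ->
  (forall t, t \in `[a, b] -> \forall s \near t, s \in `[a, b] ->
     (s <= t -> g s <= g t) /\ (t <= s -> g t <= g s)) ->
  g a <= g b.
Proof.
move=> ab loc; pose A := [set x | x \in `[a, b] /\ forall y, y \in `[a, x] -> g a <= g y].
have Aa : A a.
  split=> [|y]; first by rewrite in_itv/= lexx.
  by rewrite in_itv/= -eq_le => /eqP <-.
have Ab x : A x -> x <= b by move=> [/itvP ->].
have supA : has_sup A by split; [exists a|exists b => x /Ab].
pose c := sup A.
have ac : a <= c by apply: sup_upper_bound.
have cb : c <= b by apply: ge_sup; [exists a|move=> x /Ab].
have cab : c \in `[a, b] by rewrite in_itv/= ac cb.
have /nbhs_ballP[d /= d0 hd] := loc _ cab.
have Ac : A c.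
  split=> // y; rewrite in_itv/= => /andP[ay]; rewrite le_eqVlt => /predU1P[->|yc].
    have [x Ax xc] := sup_adherent d0 supA.
    have xc' : x <= c by exact: sup_upper_bound.
    have [xab Ax'] := Ax.
    apply: le_trans (Ax' x _) _; first by rewrite in_itv/= lexx (itvP xab).
    by apply: (hd x _ xab).1 => //; rewrite /ball/= ger0_norm ?subr_ge0//; move: xc; rewrite -/c; lra.
  have [x Ax yx] := sup_adherent (ltac:(by rewrite subr_gt0) : 0 < c - y) supA.
  by apply: Ax.2; rewrite in_itv/= ay/=; move: yx; rewrite -/c; lra.
have [cb'|cb'] := eqVneq c b.
  by apply: Ac.2; rewrite in_itv/= cb' ab lexx.
have {}cb' : c < b by rewrite lt_neqAle cb'.
pose x := Num.min b (c + d / 2).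
have cx : c < x by rewrite lt_min cb' ltrDl divr_gt0.
suff /(sup_upper_bound supA) : A x by rewrite leNgt cx.
split; first by rewrite in_itv/= ge_min lexx/= (le_trans ac (ltW cx)).
move=> y; rewrite in_itv/= => /andP[ay yx].
have [yc|cy] := leP y c; first by apply: Ac.2; rewrite in_itv/= ay.
apply: (@le_trans _ _ (g c)); first by apply: Ac.2; rewrite in_itv/= ac lexx.
move: yx; rewrite le_min => /andP[yb ycd].
have yab : y \in `[a, b] by rewrite in_itv/= ay yb.
apply: (hd y _ yab).2; last exact: ltW.
by rewrite /ball/= ltr0_norm ?subr_lt0//; lra.
Qed.

(* Apply [locally_ndecr] to [e I - Phi] and [e I + Phi], and let [e] tend to 0. *)
Lemma increment_eq a b Phi I : a <= b ->
  (forall e t, 0 < e -> t \in `[a, b] -> \forall s \near t, s \in `[a, b] ->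
     `|Phi s - Phi t| <= e * `|I s - I t|) ->
  {in `[a, b] &, {homo I : s t / s <= t}} -> Phi a = Phi b.
Proof.
move=> ab loc ndI.
have step (sg : R) : `|sg| = 1 -> forall e, 0 < e -> sg * Phi a + e * I a <= sg * Phi b + e * I b.
  move=> sg1 e e0; apply: (@locally_ndecr a b (fun t => sg * Phi t + e * I t)) => // t tab.
  have := loc e t e0 tab; apply: filterS => s h sab; have {}h := h sab.
  have hs : `|sg * Phi s - sg * Phi t| <= e * `|I s - I t|.
    by rewrite -mulrBr normrM sg1 mul1r.
  split=> [st|ts].
    have Ist := ndI _ _ sab tab st.
    move: hs; rewrite (ler0_norm (x := I s - I t)) ?subr_le0// ler_norml => /andP[_].
    by lra.
  have Its := ndI _ _ tab sab ts.
  move: hs; rewrite (ger0_norm (x := I s - I t)) ?subr_ge0// ler_norml => /andP[].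
  by lra.
have Iab : 0 <= I b - I a by rewrite subr_ge0 ndI ?in_itv/= ?lexx ?ab.
have key (sg : R) : `|sg| = 1 -> sg * Phi a <= sg * Phi b.
  move=> sg1; apply/ler_addgt0Pr => e e0.
  have k0 : 0 < I b - I a + 1 by lra.
  have := step sg sg1 _ (divr_gt0 e0 k0).
  have : e / (I b - I a + 1) * (I b - I a) <= e.
    by rewrite mulrAC ler_pdivrMr// ler_pM2l//; lra.
  by rewrite mulrBr; lra.
have := key 1 (normr1 _); have := key (-1) (normrN1 _).
by move=> h1 h2; apply/le_anti; rewrite !mul1r in h2; rewrite !mulN1r in h1; rewrite h2 -lerN2 h1.
Qed.

End RealInduction.

(** * Continuity and differentiability in time of pairings *)

Section SipTime.
Context {R : realType} {E : lmodType R} {X : set E} {B : E -> E -> R}.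
Hypothesis HB : semi_ip X B.
Implicit Types (x y w : E) (u v du dv : R -> E) (T s t a b : R).

Lemma sip_snorm_cvg0 {I : Type} (F : set_system I) {FF : Filter F} (f : I -> E) :
  B (f i) (f i) @[i --> F] --> (0 : R) -> snorm B (f i) @[i --> F] --> (0 : R).
Proof.
move=> f0; rewrite -[X in _ --> X](@sqrtr0 R) /snorm.
by apply: continuous_cvg => //; exact: sqrt_continuous.
Qed.

Lemma sip_cvg0 {I : Type} (F : set_system I) {FF : Filter F} (f g : I -> E) (l : R) :
  (\forall i \near F, X (f i)) -> (\forall i \near F, X (g i)) ->
  snorm B (f i) @[i --> F] --> (0 : R) -> snorm B (g i) @[i --> F] --> l ->
  B (f i) (g i) @[i --> F] --> (0 : R).
Proof.
move=> Xf Xg f0 gl.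
have fg0 : snorm B (f i) * snorm B (g i) @[i --> F] --> (0 : R).
  by rewrite -[X in _ --> X](mul0r l); exact: cvgM.
apply: (@squeeze_cvgr _ _ _ _ (fun i => - (snorm B (f i) * snorm B (g i)))
  (fun i => snorm B (f i) * snorm B (g i))) => //; last first.
  by rewrite -[X in _ --> X]oppr0; exact: cvgN.
near=> i; rewrite -ler_norml; apply: (sip_CS HB); near: i; [exact: Xf|exact: Xg].
Unshelve. all: by end_near. Qed.

(** Expand the pairing around [x] and [y]: three of the four terms tend to 0 by Cauchy-Schwarz. *)
Lemma sip_cvg {I : Type} (F : set_system I) {FF : Filter F} (f g : I -> E) x y :
  X x -> X y -> (\forall i \near F, X (f i)) -> (\forall i \near F, X (g i)) ->
  B (f i - x) (f i - x) @[i --> F] --> (0 : R) ->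
  B (g i - y) (g i - y) @[i --> F] --> (0 : R) ->
  B (f i) (g i) @[i --> F] --> B x y.
Proof.
move=> Xx Xy Xf Xg /sip_snorm_cvg0 f0 /sip_snorm_cvg0 g0.
have Xfx : \forall i \near F, X (f i - x).
  by apply: filterS Xf => i Xfi; exact: (sipXB HB).
have Xgy : \forall i \near F, X (g i - y).
  by apply: filterS Xg => i Xgi; exact: (sipXB HB).
have h1 : B (f i - x) (g i - y) @[i --> F] --> (0 : R) by exact: sip_cvg0 f0 g0.
have h2 : B (f i - x) y @[i --> F] --> (0 : R).
  by apply: (@sip_cvg0 _ _ _ _ _ (snorm B y)) => //; [exact: nearW|exact: cvg_cst].
have h3 : B (g i - y) x @[i --> F] --> (0 : R).
  by apply: (@sip_cvg0 _ _ _ _ _ (snorm B x)) => //; [exact: nearW|exact: cvg_cst].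
have : B (f i - x) (g i - y) + B (f i - x) y + B (g i - y) x + B x y @[i --> F]
    --> 0 + 0 + 0 + B x y.
  by apply: cvgD; [apply: cvgD => //; exact: cvgD|exact: cvg_cst].
rewrite !add0r; apply: cvg_trans; apply: near_eq_cvg; near=> i.
have Xfi : X (f i) by near: i.
have Xgi : X (g i) by near: i.
have [Xfxi Xgyi] : X (f i - x) /\ X (g i - y) by split; exact: (sipXB HB).
rewrite /= !(sipBl HB)// !(sipBr HB)// (sipC HB (g i) x) (sipC HB y x); ring.
Unshelve. all: by end_near. Qed.

Definition sip_cont T u :=
  (forall t, t \in `[0, T] -> X (u t)) /\
  forall t, t \in `[0, T] ->
    B (u s - u t) (u s - u t) @[s --> within `[0, T] (nbhs t)] --> (0 : R).

Definition sip_diff T u du :=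
  forall t, t \in `[0, T] ->
    B ((s - t)^-1 *: (u s - u t) - du t) ((s - t)^-1 *: (u s - u t) - du t)
      @[s --> within `[0, T] (dnbhs t)] --> (0 : R).

Lemma sip_cont_cst T w : X w -> sip_cont T (fun _ => w).
Proof.
move=> Xw; split=> // t _; under eq_fun do rewrite subrr (sip0l HB (sip0 HB)).
exact: cvg_cst.
Qed.

Lemma sip_cont_within T u v : sip_cont T u -> sip_cont T v ->
  {within `[0, T], continuous (fun t => B (u t) (v t))}.
Proof.
move=> [Xu cu] [Xv cv]; apply/subspace_continuousP => t tT.
apply: sip_cvg; [exact: Xu|exact: Xv| | |exact: cu|exact: cv].
  by near=> s; apply: Xu; near: s; exact: withinT.
by near=> s; apply: Xv; near: s; exact: withinT.
Unshelve. all: by end_near. Qed.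

Let near_shift0 t (P : set R) :
  (\forall s \near t^', P s) -> \forall h \near (0 : R)^', P (h + t).
Proof.
move=> tP; have : \forall s \near t, s != t -> P s by exact: tP.
rewrite (near_shift 0 t) subr0 => H.
suff : \forall h \near (0 : R), h != 0 -> P (h + t) by [].
apply: filterS H => h /= H h0; apply: H.
by rewrite -subr_eq0 addrK.
Qed.

Let near_in_itv T t : t \in `]0, T[ -> \forall s \near t^', s \in `[0, T].
Proof.
move=> tT; apply: nbhs_dnbhs; apply: filterS (near_in_itvoo tT) => s.
exact: subset_itv_oo_cc.
Qed.

Let cvg_shift_within T t (f : R -> R) (l : R) : t \in `]0, T[ ->
  f s @[s --> within `[0, T] (dnbhs t)] --> l ->
  f (h + t) @[h --> (0 : R)^'] --> l.
Proof.
move=> /near_in_itv tT fl U /fl UT; apply: (@near_shift0 t (fun s => U (f s))).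
have {}UT : \forall s \near t^', s \in `[0, T] -> U (f s) by exact: UT.
by apply: filterS2 tT UT => s sT; exact.
Qed.

Let within_dnbhs (A P : set R) t :
  within A (nbhs t) P -> within A (dnbhs t) P.
Proof. by move=> h; exact: (@nbhs_dnbhs R t [set s | A s -> P s]). Qed.

Lemma sip_is_derive T u du v dv t : sip_cont T u -> sip_cont T v ->
  sip_diff T u du -> sip_diff T v dv -> X (du t) -> X (dv t) -> t \in `]0, T[ ->
  is_derive t 1 (fun s => B (u s) (v s)) (B (du t) (v t) + B (u t) (dv t)).
Proof.
move=> [Xu cu] [Xv cv] hu hv Xdu Xdv t0T.
have tT : t \in `[0, T] by apply: subset_itv_oo_cc.
have [Xut Xvt] : X (u t) /\ X (v t) by split; [exact: Xu|exact: Xv].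
apply/is_derive_cvg.
pose q s := (s - t)^-1 *: (u s - u t); pose r s := (s - t)^-1 *: (v s - v t).
(* The difference quotient of [B (u s) (v s)], split as in the product rule. *)
pose quot s := B (q s) (v s) + B (u t) (r s).
have Xnear (w : R -> E) : (forall s, s \in `[0, T] -> X (w s)) ->
    \forall s \near within `[0, T] (dnbhs t), X (w s).
  by move=> Xw; near=> s; apply: Xw; near: s; exact: withinT.
have : quot s @[s --> within `[0, T] (dnbhs t)] --> B (du t) (v t) + B (u t) (dv t).
  apply: cvgD; apply: sip_cvg => //.
  - apply: Xnear => s sT; apply: (sipXZ HB); apply: (sipXB HB) => //; exact: Xu.
  - exact: Xnear.
  - exact: hu.
  - by move=> U /(cv t tT); exact: within_dnbhs.
  - exact: nearW.
  - apply: Xnear => s sT; apply: (sipXZ HB); apply: (sipXB HB) => //; exact: Xv.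
  - under eq_fun do rewrite subrr (sip0l HB (sip0 HB)); exact: cvg_cst.
  - exact: hv.
move=> /(cvg_shift_within t0T); apply: cvg_trans; apply: near_eq_cvg.
near=> h.
have htT : h + t \in `[0, T].
  by near: h; apply: (@near_shift0 t (fun s => s \in `[0, T])); exact: near_in_itv.
have [Xuh Xvh] : X (u (h + t)) /\ X (v (h + t)) by split; [exact: Xu|exact: Xv].
rewrite /quot /q /r addrK [h *: 1]mulr1 (sipZl HB)//; last exact: (sipXB HB).
rewrite (sipZr HB)//; last exact: (sipXB HB).
by rewrite (sipBl HB)// (sipBr HB)// /GRing.scale/=; ring.
Unshelve. all: by end_near. Qed.

Lemma sip_FTC T u du v dv a b : sip_cont T u -> sip_cont T v ->
  sip_cont T du -> sip_cont T dv -> sip_diff T u du -> sip_diff T v dv ->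
  0 <= a -> a <= b -> b <= T ->
  \int[lebesgue_measure]_(r in `[a, b]) (B (du r) (v r) + B (u r) (dv r)) =
  B (u b) (v b) - B (u a) (v a).
Proof.
move=> cu cv cdu cdv hu hv a0; rewrite le_eqVlt => /predU1P[<- _|ab bT].
  by rewrite set_itv1 Rintegral_set1 subrr.
have sub : [set` `[a, b]] `<=` [set` `[0, T]].
  by move=> r /=; rewrite !in_itv/= => /andP[ar rb]; rewrite (le_trans a0 ar) (le_trans rb bT).
have cf : {within `[a, b], continuous (fun t => B (u t) (v t))}.
  exact: continuous_subspaceW sub (sip_cont_within cu cv).
have cdf : {within `[a, b], continuous (fun r => B (du r) (v r) + B (u r) (dv r))}.
  apply: (@continuous_subspaceW _ _ _ `[0, T]%classic) => //.
  by move=> r; apply: cvgD; exact: sip_cont_within.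
have dr r : r \in `]a, b[ -> is_derive r 1 (fun t => B (u t) (v t))
    (B (du r) (v r) + B (u r) (dv r)).
  rewrite in_itv/= => /andP[ar rb].
  have rT : r \in `]0, T[ by rewrite in_itv/= (le_lt_trans a0 ar) (lt_le_trans rb bT).
  have rT' : r \in `[0, T] by exact: subset_itv_oo_cc.
  by apply: sip_is_derive rT => //; [exact: cdu.1|exact: cdv.1].
rewrite /Rintegral (@continuous_FTC2 _ _ (fun t => B (u t) (v t)) a b)//.
  move/(continuous_within_itvP _ ab) : cf => [_ ca cb]; split => // r rab.
  by have [] := dr r rab.
by move=> r rab; rewrite derive1E; have [_ ->] := dr r rab.
Qed.

End SipTime.
Arguments sip_cont {R E} X B T u.
Arguments sip_diff {R E} B T u du.

(** * From a weak time derivative to increments *)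

Section WeakFTC.
Context {R : realType}.
Implicit Types (T s t r : R) (n : nat) (h d f : R -> R).
Local Notation mu := (@lebesgue_measure R).

Lemma within_continuous_integrable a b h :
  {within `[a, b], continuous h} -> mu.-integrable `[a, b] (EFin \o h).
Proof. by move=> ch; apply: continuous_compact_integrable => //; exact: segment_compact. Qed.

(** Rises from 0 at [s] to 1 at [s + 1 / (n + 1)], so its derivative is a nonnegative kernel of mass
    1 that concentrates at [s]. *)
Definition ramp n s r : R := sstep (n.+1%:R * r + - (n.+1%:R * s)).

Lemma sm_ramp n s : sm (ramp n s).
Proof. exact: (@sm_aff _ sstep _ _ sm_sstep). Qed.

Lemma ramp_eq0 n s r : r <= s -> ramp n s r = 0.
Proof. by move=> rs; rewrite /ramp -mulrBr sstep_eq0// pmulr_rle0// subr_le0. Qed.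

Lemma ramp_eq1 n s r : s + n.+1%:R^-1 <= r -> ramp n s r = 1.
Proof.
move=> sr; rewrite /ramp -mulrBr sstep_eq1// -ler_pdivrMl// mulr1.
by rewrite lerBrDl.
Qed.

Lemma ramp_homo n s r r' : r <= r' -> ramp n s r <= ramp n s r'.
Proof. by move=> rr; apply: sstep_homo; rewrite lerD2r ler_pM2l. Qed.

Lemma ramp_derive1_ge0 n s r : 0 <= derive1 (ramp n s) r.
Proof.
have /is_derive_cvg h := sm_is_derive r (sm_ramp n s).
rewrite -(cvg_lim _ h)//; apply: limr_ge; first by apply/cvg_ex; eexists; exact: h.
near=> t; rewrite [_%:A]mulr1 /GRing.scale/=.
have [t0|t0] := leP 0 t.
  by rewrite mulr_ge0 ?invr_ge0// subr_ge0 ramp_homo// lerDr.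
rewrite mulr_le0//; first by rewrite invr_le0 ltW.
by rewrite subr_le0 ramp_homo// gerDr ltW.
Unshelve. all: by end_near. Qed.

Lemma ramp_derive1_eq0 n s r : r \notin `[s, s + n.+1%:R^-1] ->
  derive1 (ramp n s) r = 0.
Proof.
rewrite in_itv/= negb_and -!ltNge => rs.
have loc (c : R) : (\forall y \near r, ramp n s y = c) -> derive1 (ramp n s) r = 0.
  move=> E; rewrite derive1E.
  have : is_derive r 1 (ramp n s) 0.
    by apply: (@near_is_derive _ _ (cst c)); apply: filterS E => y ->.
  by case.
case/orP: rs => rs; [apply: (loc 0)|apply: (loc 1)]; near=> y.
  by apply: ramp_eq0; near: y; exact: lt_le_nbhsl.
by apply: ramp_eq1; near: y; exact: lt_le_nbhsr.
Unshelve. all: by end_near. Qed.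

Lemma ramp_FTC n s a b : a <= b ->
  \int[mu]_(r in `[a, b]) derive1 (ramp n s) r = ramp n s b - ramp n s a.
Proof.
rewrite le_eqVlt => /predU1P[<-|ab]; first by rewrite set_itv1 Rintegral_set1 subrr.
have sr := sm_ramp n s; have cr := sm_continuous sr.
rewrite /Rintegral (@continuous_FTC2 _ _ (ramp n s) a b)//.
- by apply: continuous_subspaceT; apply: sm_continuous; exact: sm_derive1.
- split; [by move=> r _; exact: sm_derivable| |].
  + by apply: cvg_at_right_filter; exact: cr.
  + by apply: cvg_at_left_filter; exact: cr.
Qed.

Lemma cvg_ramp_derive T s h : s \in `]0, T[ -> {within `[0, T], continuous h} ->
  \int[mu]_(r in `[0, T]) (derive1 (ramp n s) r * h r) @[n --> \oo] --> h s.
Proof.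
move=> sT ch; move: (sT); rewrite in_itv/= => /andP[s0 sltT].
have Ts0 : 0 < T - s by rewrite subr_gt0.
have T0 : 0 <= T by rewrite (le_trans (ltW s0))// ltW.
have sT' : s \in `[0, T] by apply: subset_itv_oo_cc.
have cr n : {within `[0, T], continuous (derive1 (ramp n s))}.
  apply: continuous_subspaceT; apply: sm_continuous; apply: sm_derive1; exact: sm_ramp.
have Ik n : mu.-integrable `[0, T] (EFin \o derive1 (ramp n s)).
  exact: within_continuous_integrable.
have Ikh n : mu.-integrable `[0, T] (EFin \o (fun r => derive1 (ramp n s) r * h r)).
  by apply: within_continuous_integrable => r; apply: cvgM; [exact: cr|exact: ch].
apply/cvgrPdist_le => e e0.
have := ch; move=> /subspace_continuousP/(_ s sT')/cvgrPdist_le/(_ e e0) near_s.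
have /nbhs_ballP[d /= d0 hd] : \forall r \near s, r \in `[0, T] -> `|h s - h r| <= e by [].
near=> n.
have nd : n.+1%:R^-1 < d by near: n; exact: (near_infty_natSinv_lt (PosNum d0)).
have nT : s + n.+1%:R^-1 <= T.
  by rewrite -lerBrDl ltW//; near: n; exact: (near_infty_natSinv_lt (PosNum Ts0)).
have k1 : \int[mu]_(r in `[0, T]) derive1 (ramp n s) r = 1.
  by rewrite ramp_FTC// ramp_eq1// ramp_eq0 ?subr0// ltW.
have -> : h s = \int[mu]_(r in `[0, T]) (derive1 (ramp n s) r * h s).
  by rewrite RintegralZr// k1 mul1r.
rewrite -RintegralB//; last first.
  by apply: eq_integrable (integrableZr _ (h s) (Ik n)) => // r _; rewrite /= EFinM.
have cdiff : {within `[0, T],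
    continuous (fun r => derive1 (ramp n s) r * h s - derive1 (ramp n s) r * h r)}.
  move=> r; apply: cvgB; first by apply: cvgMl; exact: cr.
  by apply: cvgM; [exact: cr|exact: ch].
have in_ball (r : R) : s <= r -> r <= s + n.+1%:R^-1 -> ball s d r.
  move=> sr rs; rewrite /ball/= ler0_norm ?subr_le0//.
  by rewrite opprB (le_lt_trans _ nd)// lerBlDl.
apply: le_trans (le_normr_Rintegral _ _) _ => //.
  exact: within_continuous_integrable.
rewrite -[leRHS]mul1r -k1 -RintegralZr//.
apply: le_Rintegral => //.
- by apply: within_continuous_integrable => r; apply: cvg_norm; exact: cdiff.
- by apply: within_continuous_integrable => r; apply: cvgMl; exact: cr.
move=> r rT; rewrite -mulrBr normrM ger0_norm ?ramp_derive1_ge0//.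
have [rs|rs] := boolP (r \in `[s, s + n.+1%:R^-1]); last by rewrite ramp_derive1_eq0 ?mul0r.
rewrite ler_wpM2l ?ramp_derive1_ge0//; apply: hd => //.
by move: rs; rewrite in_itv/= => /andP[]; exact: in_ball.
Unshelve. all: by end_near. Qed.

(* The test functions [ramp n s - ramp n t] tend to the indicator of ]s, t]
   while their derivatives concentrate at s and at t. *)
Lemma weak_FTC T h d s t : {within `[0, T], continuous h} ->
  mu.-integrable `[0, T] (EFin \o d) ->
  (forall f, test_fun1 T f ->
     \int[mu]_(r in `]0, T[) (derive1 f r * h r) = - \int[mu]_(r in `]0, T[) (f r * d r)) ->
  0 < s -> s <= t -> t < T -> h t - h s = \int[mu]_(r in `[s, t]) d r.
Proof.
move=> ch Id weak s0 st tT.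
have t0 : 0 < t by exact: lt_le_trans st.
have sT : s < T by exact: le_lt_trans tT.
have Tt0 : 0 < T - t by rewrite subr_gt0.
pose f n r := ramp n s r + -1 * ramp n t r.
have f01 n r : 0 <= f n r <= 1.
  have -> : f n r = ramp n s r - ramp n t r by rewrite /f mulN1r.
  apply/andP; split.
    rewrite subr_ge0; apply: sstep_homo; rewrite lerD2l lerN2 ler_pM2l//.
  by rewrite lerBlDr (le_trans (sstep_le1 _))// lerDl; exact: sstep_ge0.
have smf n : sm (f n).
  apply: sm_add; first exact: sm_ramp.
  by apply: (@sm_mul _ (cst (-1))); [exact: sm_cst|exact: sm_ramp].
have df n r : derive1 (f n) r = derive1 (ramp n s) r - derive1 (ramp n t) r.
  have h1 := sm_is_derive r (sm_ramp n s); have h2 := sm_is_derive r (sm_ramp n t).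
  rewrite derive1E (_ : f n = ramp n s - ramp n t).
    by have [_ ->] := is_deriveB h1 h2.
  by apply/funext => y; rewrite /f mulN1r.
(* The support of [f n] reaches [t + 1 / (n + 1)], which is below [T] only for large [n]. *)
have tf : \forall n \near \oo, test_fun1 T (f n).
  near=> n; split; first by move=> k r; apply: sm_derivable; exact: sm_derive1n.
  have nT : t + n.+1%:R^-1 < T.
    by rewrite -ltrBrDl; near: n; exact: (near_infty_natSinv_lt (PosNum Tt0)).
  exists s, (t + n.+1%:R^-1); split => // r.
  rewrite in_itv/= negb_and -!ltNge /f => /orP[rs|tr].
    by rewrite !ramp_eq0 ?mulr0 ?addr0//; [exact: ltW (lt_le_trans rs st)|exact: ltW].
  rewrite !ramp_eq1 ?mulr1 ?subrr//; first exact: ltW.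
  by apply: le_trans (ltW tr); rewrite lerD2r.
have Ir n x : x \in `]0, T[ ->
    mu.-integrable `[0, T] (EFin \o (fun r => derive1 (ramp n x) r * h r)).
  move=> xT; apply: within_continuous_integrable => r; apply: cvgM; last exact: ch.
  move: r; apply: continuous_subspaceT; apply: sm_continuous; apply: sm_derive1.
  exact: sm_ramp.
have sT' : s \in `]0, T[ by rewrite in_itv/= s0.
have tT' : t \in `]0, T[ by rewrite in_itv/= t0.
have lim1 : \int[mu]_(r in `[0, T]) (derive1 (f n) r * h r) @[n --> \oo] --> h s - h t.
  have -> : (fun n => \int[mu]_(r in `[0, T]) (derive1 (f n) r * h r)) = fun n =>
      \int[mu]_(r in `[0, T]) (derive1 (ramp n s) r * h r) -
      \int[mu]_(r in `[0, T]) (derive1 (ramp n t) r * h r).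
    apply/funext => n; rewrite -RintegralB//; [|exact: Ir..].
    by apply: eq_Rintegral => r _; rewrite df mulrBl.
  by apply: cvgB; exact: cvg_ramp_derive.
have cf r : f n r @[n --> \oo] --> (\1_(`]s, t]%classic) r : R).
  have r1 x : x < r -> \forall n \near \oo, ramp n x r = 1.
    move=> xr; have rx0 : 0 < r - x by rewrite subr_gt0.
    near=> n; apply: ramp_eq1; rewrite -lerBrDl ltW//; near: n.
    exact: (near_infty_natSinv_lt (PosNum rx0)).
  rewrite indicE; have [rs|sr] := leP r s.
    rewrite memNset; last by rewrite /= in_itv/= ltNge rs.
    apply: cvg_near_cst; apply: nearW => n.
    by rewrite /f !ramp_eq0 ?mulr0 ?addr0// (le_trans rs).
  have [rt|tr] := leP r t.
    rewrite mem_set; last by rewrite /= in_itv/= sr.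
    apply: cvg_near_cst; apply: filterS (r1 s sr) => n.
    by rewrite /f => ->; rewrite ramp_eq0// mulr0 addr0.
  rewrite memNset; last by rewrite /= in_itv/= sr/= leNgt tr.
  apply: cvg_near_cst; apply: filterS2 (r1 s sr) (r1 t tr) => n.
  by rewrite /f => -> ->; rewrite mulr1 subrr.
have st0T : [set` `]s, t]] `<=` [set` `[0, T]].
  move=> r /=; rewrite !in_itv/= => /andP[sr rt].
  by rewrite (le_trans (ltW s0) (ltW sr)) (le_trans rt (ltW tT)).
have Ist : mu.-integrable `]s, t] (EFin \o d) by exact: integrableS Id.
have md : measurable_fun `[0, T] d by apply/measurable_EFinP; exact: measurable_int Id.
have mf n : measurable_fun `[0, T] (f n).
  by apply: measurable_funTS; apply: continuous_measurable_fun; exact: sm_continuous.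
have mfd n : measurable_fun `[0, T] (EFin \o (fun r => f n r * d r)).
  by apply/measurable_EFinP; exact: (measurable_funM (mf n) md).
have lim2 : \int[mu]_(r in `[0, T]) (f n r * d r) @[n --> \oo]
    --> \int[mu]_(r in `[s, t]) d r.
  rewrite -Rintegral_itv_obnd_cbnd//; apply: fine_cvg; rewrite fineK; last first.
    by apply: integrable_fin_num.
  have -> : (\int[mu]_(r in `]s, t]) (d r)%:E =
      \int[mu]_(r in `[0%R, T]) (\1_(`]s, t]%classic) r * d r)%:E)%E.
    rewrite -[in LHS](setIidr st0T) integral_mkcondr; apply: eq_integral => r _.
    by rewrite /patch indicE; case: ifP; rewrite ?mul1r ?mul0r.
  apply: (@dominated_cvg _ _ _ mu `[0, T]%classic _ (fun n r => (f n r * d r)%:E)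
    (fun r => (\1_(`]s, t]%classic) r * d r)%:E) (fun r => `|(d r)%:E|%E)) => //.
  - by move=> r _; apply: cvg_EFin; [exact: nearW|apply: cvgMl; exact: cf].
  - exact: integrable_abse.
  - move=> n r _; rewrite /= lee_fin normrM; have /andP[f0 f1] := f01 n r.
    by rewrite ger0_norm// ler_piMl.
have oo_cc (phi : R -> R) : mu.-integrable `[0, T] (EFin \o phi) ->
    \int[mu]_(r in `]0, T[) phi r = \int[mu]_(r in `[0, T]) phi r.
  move=> Iphi; rewrite Rintegral_itv_bndo_bndc ?Rintegral_itv_obnd_cbnd//.
    by apply: integrableS Iphi => //; exact: subset_itv_oc_cc.
  by apply: integrableS Iphi => //; exact: subset_itv_oo_cc.
have lim3 : \int[mu]_(r in `[0, T]) (derive1 (f n) r * h r) @[n --> \oo] -->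
    - \int[mu]_(r in `[s, t]) d r.
  apply: cvg_trans (cvgN lim2); apply: near_eq_cvg; near=> n.
  have Ifh : mu.-integrable `[0, T] (EFin \o (fun r => derive1 (f n) r * h r)).
    apply: within_continuous_integrable => r; apply: cvgM; last exact: ch.
    move: r; apply: continuous_subspaceT; apply: sm_continuous; exact: sm_derive1.
  have Ifd : mu.-integrable `[0, T] (EFin \o (fun r => f n r * d r)).
    apply: (le_integrable _ _ _ Id) => //; first exact: mfd.
    move=> r _; rewrite /= lee_fin normrM; have /andP[f0 f1] := f01 n r.
    by rewrite ger0_norm// ler_piMl.
  transitivity (- \int[mu]_(r in `[0, T]) (f n r * d r)); first by [].
  by rewrite -(oo_cc _ Ifh) -(oo_cc _ Ifd) weak//; near: n.
have : h s - h t = - \int[mu]_(r in `[s, t]) d r.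
  by apply: cvg_unique lim1 lim3.
by move=> E; rewrite -[RHS]opprK -E opprB.
Unshelve. all: by end_near. Qed.

Lemma within_cst_continuous T Phi (c : R) : 0 < T -> {within `[0, T], continuous Phi} ->
  (forall t, t \in `]0, T[ -> Phi t = c) -> forall t, t \in `[0, T] -> Phi t = c.
Proof.
move=> T0 /(continuous_within_itvP _ T0)[_ c0 cT] Pc t; rewrite in_itv/= => /andP[t0 tT].
have [E|tn0] := eqVneq t 0.
  rewrite E; apply: cvg_unique c0 _ => //; apply: cvg_near_cst; near=> s.
  by apply: Pc; rewrite in_itv/=; apply/andP; split; near: s;
    [exact: nbhs_right_gt|exact: nbhs_right_lt].
have [E|tnT] := eqVneq t T.
  rewrite E; apply: cvg_unique cT _ => //; apply: cvg_near_cst; near=> s.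
  by apply: Pc; rewrite in_itv/=; apply/andP; split; near: s;
    [exact: nbhs_left_gt|exact: nbhs_left_lt].
by apply: Pc; rewrite in_itv/= !lt_neqAle eq_sym tn0 t0 tnT tT.
Unshelve. all: by end_near. Qed.

End WeakFTC.

(** * Measurability in time of pairings *)

Section WeakMeasurability.
Context {R : realType} {E : lmodType R} {X : set E} {B : E -> E -> R}.
Hypothesis HB : semi_ip X B.
Implicit Types (u v : R -> E) (D : set (measurableTypeR R)).

Definition weakly_measurable D v :=
  (forall t, D t -> X (v t)) /\ forall w, X w -> measurable_fun D (fun t => B w (v t)).

Lemma measurable_sip_simple D v s : weakly_measurable D v ->
  simple_fun X s -> measurable_fun D (fun t => B (s t) (v t)).
Proof.
move=> [Xv mv] [n [A [a [AX es]]]] mD.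
have Ba (t : R) : D t -> B (s t) (v t) = \sum_(i < n) \1_(A i) t * B (a i) (v t).
  move=> Dt; rewrite es.
  (* [B] is additive only on [X], so the sum is split by an induction that keeps track of membership
     in [X]. *)
  suff : forall m (F : 'I_m -> E), (forall i, X (F i)) ->
      B (\sum_i F i) (v t) = \sum_i B (F i) (v t).
    move=> ->; first by apply: eq_bigr => i _; rewrite (sipZl HB)//; [case: (AX i)|exact: Xv].
    by move=> i; apply: (sipXZ HB); case: (AX i).
  elim=> [|m ih] F XF; first by rewrite !big_ord0 (sip0l HB)//; exact: Xv.
  rewrite !big_ord_recl (sipDl HB)//; first by rewrite ih.
    by elim/big_ind : _ => //; [exact: (sip0 HB)|move=> x y; exact: (sipXD HB)].
  exact: Xv.
move: mD; apply: (eq_measurable_fun (fun t => \sum_(i < n) \1_(A i) t * B (a i) (v t))).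
  by move=> t /set_mem Dt; rewrite Ba.
apply: measurable_sum => i; apply: measurable_funM.
  by apply: measurable_funTS; apply: measurable_indic; case: (AX i).
by apply: mv; case: (AX i).
Qed.

(** Simple approximations of [u] reduce the pairing of two varying fields to pairings of [v] with
    fixed vectors; a pointwise limit of measurable functions finishes. *)
Lemma measurable_sip_strong D u v s : weakly_measurable D v ->
  (forall t, D t -> X (u t)) -> (forall n, simple_fun X (s n)) ->
  (forall t, D t -> B (s n t - u t) (s n t - u t) @[n --> \oo] --> (0 : R)) ->
  measurable_fun D (fun t => B (u t) (v t)).
Proof.
move=> wv Xu ss su.
apply: (@measurable_fun_cvg _ _ _ D (fun n t => B (s n t) (v t))).
  by move=> n; exact: measurable_sip_simple.
move=> t Dt; have Xs n : X (s n t).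
  have [m [A [a [AX ->]]]] := ss n; elim/big_ind : _ => //.
  - exact: (sip0 HB).
  - by move=> x y; exact: (sipXD HB).
  - by move=> i _; apply: (sipXZ HB); case: (AX i).
apply: (sip_cvg HB); [exact: Xu|exact: wv.1|exact: nearW| |exact: su|].
  by apply: nearW => n; exact: wv.1.
by under eq_fun do rewrite subrr (sip0l HB (sip0 HB)); exact: cvg_cst.
Qed.

Lemma weakly_measurable_strong D u s : (forall t, D t -> X (u t)) ->
  (forall n, simple_fun X (s n)) ->
  (forall t, D t -> B (s n t - u t) (s n t - u t) @[n --> \oo] --> (0 : R)) ->
  weakly_measurable D u.
Proof.
move=> Xu ss su; split=> // w Xw; under eq_fun do rewrite (sipC HB).
by apply: measurable_sip_strong ss su => //; split.
Qed.

Lemma sip_cont_weakly_measurable T D v : measurable D -> D `<=` `[0, T]%classic ->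
  sip_cont X B T v -> weakly_measurable D v.
Proof.
move=> mD DT cv; split=> [t /DT|w Xw]; first exact: cv.1.
apply: (measurable_funS _ DT) => //; apply: subspace_continuous_measurable_fun => //.
by apply: (sip_cont_within HB) => //; exact: sip_cont_cst.
Qed.

End WeakMeasurability.
Arguments weakly_measurable {R E} X B D v.

Section ItvIntegrable.
Context {R : realType} (i : interval R).
Local Notation mu := (@lebesgue_measure R).
Implicit Types (f h : R -> R) (c : R).

Let mi : measurable ([set` i] : set (measurableTypeR R)).
Proof. exact: measurable_itv. Qed.

Lemma itv_integrableD f h : mu.-integrable [set` i] (EFin \o f) ->
  mu.-integrable [set` i] (EFin \o h) ->
  mu.-integrable [set` i] (EFin \o (fun r => f r + h r)).
Proof. by move=> If Ih; exact: (integrableD mi If Ih). Qed.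

Lemma itv_integrableZ c f : mu.-integrable [set` i] (EFin \o f) ->
  mu.-integrable [set` i] (EFin \o (fun r => c * f r)).
Proof. by move=> If; exact: (integrableZl mi c If). Qed.

Lemma itv_integrableB f h : mu.-integrable [set` i] (EFin \o f) ->
  mu.-integrable [set` i] (EFin \o h) ->
  mu.-integrable [set` i] (EFin \o (fun r => f r - h r)).
Proof. by move=> If Ih; exact: (integrableB mi If Ih). Qed.

End ItvIntegrable.

(** * The chain rule for the square of a quasi-static field *)

Section ChainRule.
Context {R : realType} {E : lmodType R} {X : set E} {B : E -> E -> R}.
Hypothesis HB : semi_ip X B.
Local Notation mu := (@lebesgue_measure R).

(* A weak form of L^2(0, T; X): only the pairings of [g] that occur need be
   measurable. *)
Record sip_L2 (T : R) (g : R -> E) : Prop := SipL2 {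
  sip_L2_mem : forall t, X (g t);
  sip_L2_int : mu.-integrable `[0, T] (fun t => (B (g t) (g t))%:E);
  sip_L2_meas : forall v, sip_cont X B T v ->
    measurable_fun `[0, T] (fun t => B (g t) (v t))
}.

Lemma sip_cont_integrable T u v : sip_cont X B T u -> sip_cont X B T v ->
  mu.-integrable `[0, T] (EFin \o (fun t => B (u t) (v t))).
Proof.
by move=> cu cv; apply: within_continuous_integrable; exact: (sip_cont_within HB).
Qed.

Lemma sip_L2_integrable T g v : sip_L2 T g -> sip_cont X B T v ->
  mu.-integrable `[0, T] (EFin \o (fun t => B (g t) (v t))).
Proof.
move=> [Xg Ig mg] cv; have Iv := sip_cont_integrable cv cv.
apply: (le_integrable _ _ _ (integrableD _ Ig Iv)) => //.
  by apply/measurable_EFinP; exact: mg.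
move=> t tT; rewrite /= lee_fin [leRHS]ger0_norm ?addr_ge0 ?(sip_ge0 HB)//.
have := sip_young HB (ltr01 : 0 < 1) (Xg t) (cv.1 t tT).
by rewrite invr1 !mul1r; have := normr_ge0 (B (g t) (v t)); lra.
Qed.

Variables (T : R) (H e g : R -> E).
Hypotheses (T0 : 0 < T) (cH : sip_cont X B T H) (ce : sip_cont X B T e).
Hypothesis Lg : sip_L2 T g.
Hypothesis increment : forall s t : R, 0 < s -> s <= t -> t < T ->
  B (H t) (H t) - B (H s) (H s) =
  - \int[mu]_(r in `[s, t]) (B (e r) (H s + H t) + B (g r) (H s + H t)).

Let D r := 2 * (B (e r) (H r) + B (g r) (H r)).

(** An integrable majorant for the norms of [e r] and [g r], by [|x| <= (1 + |x|^2) / 2]; its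
    primitive is the comparison function for [increment_eq]. *)
Let wt r := 1 + B (e r) (e r) + B (g r) (g r).

Let sub_itv (s t : R) : 0 <= s -> t <= T -> [set` `[s, t]] `<=` [set` `[0, T]].
Proof.
by move=> s0 tT r /=; rewrite !in_itv/= => /andP[sr rt];
  rewrite (le_trans s0 sr) (le_trans rt tT).
Qed.

Let Ieg v : sip_cont X B T v ->
  mu.-integrable `[0, T] (EFin \o (fun r => B (e r) (v r) + B (g r) (v r))).
Proof.
move=> cv; exact: itv_integrableD (sip_cont_integrable ce cv) (sip_L2_integrable Lg cv).
Qed.

Let ID : mu.-integrable `[0, T] (EFin \o D).
Proof. exact: itv_integrableZ (Ieg cH). Qed.

Let Iwt : mu.-integrable `[0, T] (EFin \o wt).
Proof.
have I1 : mu.-integrable `[0, T] (EFin \o (fun=> 1 : R)).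
  by apply: within_continuous_integrable => r; exact: cvg_cst.
apply: itv_integrableD (sip_L2_int Lg).
exact: itv_integrableD I1 (sip_cont_integrable ce ce).
Qed.

Let Int (f : R -> R) (s t : R) : mu.-integrable `[0, T] (EFin \o f) -> 0 <= s -> s <= t -> t <= T ->
  \int[mu]_(r in `[0, t]) f r - \int[mu]_(r in `[0, s]) f r =
  \int[mu]_(r in `[s, t]) f r.
Proof.
move=> If s0 st tT.
have I0t : mu.-integrable `[0, t] (EFin \o f).
  by apply: integrableS If => //; exact: sub_itv.
rewrite Rintegral_itvB ?bnd_simp// Rintegral_itv_obnd_cbnd//.
apply: integrableS I0t => //.
by move=> r /=; rewrite !in_itv/= => /andP[/ltW sr ->]; rewrite (le_trans s0 sr).
Qed.

(* [Phi] is shown to be constant by [increment_eq]: on a small step, [D] differs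
   from the integrand in [increment] by a small multiple of [wt]. *)
Let Phi t := B (H t) (H t) + \int[mu]_(r in `[0, t]) D r.
Let I t := \int[mu]_(r in `[0, t]) wt r.

Let wt_ge0 r : 0 <= wt r.
Proof. by rewrite !addr_ge0 ?(sip_ge0 HB). Qed.

Let pairing_le (d : R) x y : X x -> X y -> snorm B y <= d ->
  `|B x y| <= d * ((1 + B x x) / 2).
Proof.
move=> Xx Xy yd; apply: (le_trans (sip_CS HB Xx Xy)).
have s0 := snorm_ge0 (B := B) x; have t0 := snorm_ge0 (B := B) y.
rewrite -(snorm_sqr HB x).
have : snorm B x <= (1 + snorm B x ^+ 2) / 2.
  by have := sqr_ge0 (snorm B x - 1); rewrite sqrrB1; lra.
move: (snorm B x) (snorm B y) s0 t0 yd => p q p0 q0 qd pq.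
rewrite mulrC; apply: le_trans (ler_wpM2r p0 qd) _.
by apply: ler_wpM2l => //; exact: le_trans qd.
Qed.

Let step (d s0 lo hi : R) : 0 < lo -> lo <= hi -> hi < T -> s0 \in `[0, T] ->
  (forall r : R, r \in `[lo, hi] -> snorm B (H r - H s0) <= d) ->
  `|Phi hi - Phi lo| <= 4 * d * (I hi - I lo).
Proof.
move=> lo0 lohi hiT s0T near_s0.
have sub := sub_itv (ltW lo0) (ltW hiT).
have inT r : r \in `[lo, hi] -> r \in `[0, T] by move=> /sub.
have lo_in : lo \in `[lo, hi] by rewrite in_itv/= lexx.
have hi_in : hi \in `[lo, hi] by rewrite in_itv/= lohi lexx.
have [Xlo Xhi] : X (H lo) /\ X (H hi) by split; apply: cH.1; exact: inT.
have Xs0 : X (H s0) by exact: cH.1.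
have Xw : X (H lo + H hi) by exact: (sipXD HB).
have Ilh f : mu.-integrable `[0, T] (EFin \o f) -> mu.-integrable `[lo, hi] (EFin \o f).
  by apply: integrableS.
have Iw := Ilh _ (Ieg (sip_cont_cst HB T Xw)).
have -> : Phi hi - Phi lo = \int[mu]_(r in `[lo, hi])
    (D r - (B (e r) (H lo + H hi) + B (g r) (H lo + H hi))).
  rewrite RintegralB//; last exact: Ilh.
  rewrite -(Int ID (ltW lo0) lohi (ltW hiT)) /Phi.
  by have := increment lo0 lohi hiT; lra.
have IDw : mu.-integrable `[lo, hi]
    (EFin \o (fun r => D r - (B (e r) (H lo + H hi) + B (g r) (H lo + H hi)))).
  exact: itv_integrableB (Ilh _ ID) Iw.
apply: le_trans (le_normr_Rintegral _ IDw) _ => //.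
rewrite /I (Int Iwt (ltW lo0) lohi (ltW hiT)) -RintegralZl//; last exact: Ilh.
apply: le_Rintegral => //.
- exact: integrable_norm IDw.
- exact: itv_integrableZ (Ilh _ Iwt).
move=> r rlh; have rT := inT _ rlh.
have [Xe Xg] : X (e r) /\ X (g r) by split; [exact: ce.1|exact: sip_L2_mem Lg _].
have Xr : X (H r) by exact: cH.1.
have Xd q : q \in `[lo, hi] -> X (H q - H s0).
  by move=> /inT qT; apply: (sipXB HB) => //; exact: cH.1.
(* [H s0] cancels since 2 - 1 - 1 = 0. Four differences from [H s0], counted with multiplicity and
   each of norm at most [d], account for the constant 4. *)
have split4 x : X x -> 2 * B x (H r) - B x (H lo + H hi) =
    2 * B x (H r - H s0) - B x (H lo - H s0) - B x (H hi - H s0).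
  by move=> Xx; rewrite !(sipBr HB)// (sipDr HB)//; ring.
have bnd x : X x -> `|2 * B x (H r) - B x (H lo + H hi)| <= 4 * d * ((1 + B x x) / 2).
  move=> Xx; rewrite split4//.
  have b q : q \in `[lo, hi] -> `|B x (H q - H s0)| <= d * ((1 + B x x) / 2).
    by move=> qlh; apply: pairing_le => //; [exact: Xd|exact: near_s0].
  have := b _ rlh; have := b _ lo_in; have := b _ hi_in.
  move: (B x (H r - H s0)) (B x (H lo - H s0)) (B x (H hi - H s0)) (B x x) => p q q' w.
  rewrite !ler_norml => /andP[? ?] /andP[? ?] /andP[? ?].
  by apply/andP; split; lra.
have d0 : 0 <= d by apply: le_trans (near_s0 _ lo_in); exact: snorm_ge0.
have := mulr_ge0 d0 (addr_ge0 (sip_ge0 HB (e r)) (sip_ge0 HB (g r))).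
have := bnd _ Xe; have := bnd _ Xg; rewrite /D /wt.
move: (B (e r) (H r)) (B (g r) (H r)) (B (e r) (H lo + H hi)) (B (g r) (H lo + H hi)).
move: (B (e r) (e r)) (B (g r) (g r)) => a b p q p' q'.
rewrite !ler_norml => /andP[? ?] /andP[? ?] ?.
by apply/andP; split; lra.
Qed.

Lemma quadratic_chain_rule (t : R) : t \in `[0, T] ->
  B (H t) (H t) - B (H 0) (H 0) =
  - \int[mu]_(r in `[0, t]) (2 * (B (e r) (H r) + B (g r) (H r))).
Proof.
move=> tT; have cPhi : {within `[0, T], continuous Phi}.
  move=> x; apply: cvgD; first exact: (sip_cont_within HB).
  exact: (parameterized_integral_continuous (ltW T0) ID).
have I_homo : {in `[0, T] &, {homo I : s t / s <= t}}.
  move=> a b; rewrite !in_itv/= => /andP[a0 _] /andP[_ bT] ab.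
  by rewrite -subr_ge0 /I (Int Iwt)//; apply: Rintegral_ge0.
have Phi_eq (a b : R) : 0 < a -> a <= b -> b < T -> Phi a = Phi b.
  move=> a0 ab bT; apply: (increment_eq (I := I)) => //; last first.
    by move=> p q pab qab; apply: I_homo; exact: (sub_itv (ltW a0) (ltW bT)).
  move=> eps s eps0 sab.
  have sT : s \in `[0, T] by exact: (sub_itv (ltW a0) (ltW bT)).
  have d0 : 0 < eps / 4 by rewrite divr_gt0.
  have nH : snorm B (H r - H s) @[r --> within `[0, T] (nbhs s)] --> (0 : R).
    by apply: sip_snorm_cvg0; exact: cH.2.
  have : \forall r \near s, r \in `[0, T] -> snorm B (H r - H s) <= eps / 4.
    have : \forall r \near s, r \in `[0, T] -> `|0 - snorm B (H r - H s)| <= eps / 4.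
      by move/cvgrPdist_le : nH => /(_ _ d0).
    by apply: filterS => r + rT => /(_ rT); rewrite sub0r normrN; exact: le_trans (ler_norm _).
  move=> /nbhs_ballP[rho /= rho0 hrho].
  near=> q => qab.
  have qs : ball s rho q by near: q; exact: nbhsx_ballx.
  have bnd (lo hi : R) : lo \in `[a, b] -> hi \in `[a, b] -> ball s rho lo -> ball s rho hi ->
      lo <= hi -> `|Phi hi - Phi lo| <= eps * (I hi - I lo).
    rewrite !in_itv/= => /andP[alo lob] /andP[ahi hib] blo bhi lohi.
    have -> : eps = 4 * (eps / 4) by field.
    apply: (@step _ s) => //; [exact: lt_le_trans alo|exact: le_lt_trans bT|].
    move=> r; rewrite in_itv/= => /andP[lor rhi]; apply: hrho.
      move: blo bhi; rewrite /ball/= !ltr_norml => /andP[? ?] /andP[? ?].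
      by apply/andP; split; lra.
    rewrite in_itv/= (le_trans (ltW a0) (le_trans alo lor)).
    by rewrite (le_trans rhi (le_trans hib (ltW bT))).
  have bs : ball s rho s by exact: ballxx.
  have [qles|sltq] := leP q s.
    rewrite distrC [`|I q - I s|]distrC [X in _ * X]ger0_norm; first exact: bnd.
    by rewrite subr_ge0 I_homo//; exact: (sub_itv (ltW a0) (ltW bT)).
  rewrite [X in _ * X]ger0_norm; first by apply: bnd => //; exact: ltW.
  by rewrite subr_ge0 I_homo//; [exact: (sub_itv (ltW a0) (ltW bT))|exact: ltW].
(* Increments are known only between interior times. [T / 2] is an interior reference point, and
   continuity of [Phi] brings in the endpoints. *)
have Phi_cst (s : R) : s \in `[0, T] -> Phi s = Phi (T / 2).
  apply: within_cst_continuous => // r; rewrite in_itv/= => /andP[r0 rT].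
  have [h|h] := leP r (T / 2); first by apply: Phi_eq => //; lra.
  by apply/esym; apply: Phi_eq; [lra|exact: ltW|].
have : Phi t = Phi 0 by rewrite !Phi_cst// in_itv/= lexx ltW.
rewrite /Phi set_itv1 Rintegral_set1 addr0; rewrite /D => <-.
by rewrite opprD addrA subrr add0r.
Unshelve. all: by end_near. Qed.

End ChainRule.
Arguments sip_L2 {R E} X B T g.

(** * The energy estimate *)

Section TimeRegularity.
Context {R : realType} (O : set (pt R)) (oO : open O) (bO : bounded_set O).
Implicit Types (v w : vfield R) (T : R).
Local Notation mu := (@lebesgue_measure R).

Let mO : measurable O. Proof. exact: open_pt_measurable. Qed.
Let S := vip_semi_ip mO.

Lemma vip_le_hdivsq v : vL2 O v -> ((vip O v v)%:E <= hdivsq O v)%E.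
Proof.
move=> Lv; rewrite /hdivsq vnsqE// leeDl//.
by apply: integral_ge0 => x _; rewrite lee_fin sqr_ge0.
Qed.

Lemma vip_le_spSsq v : vL2 O v -> ((vip O v v)%:E <= spSsq O v)%E.
Proof.
move=> Lv; rewrite vip_sum// /spSsq -sumEFin; apply: lee_sum => i _.
rewrite /h1sq nsqE// leeDl//; apply: sume_ge0 => j _.
by apply: integral_ge0 => x _; rewrite lee_fin sqr_ge0.
Qed.

Lemma ereal_squeeze0 {I : Type} (F : set_system I) {FF : Filter F} (N : I -> \bar R)
    (f : I -> R) : (\forall i \near F, 0 <= f i /\ ((f i)%:E <= N i)%E) ->
  N i @[i --> F] --> 0%E -> f i @[i --> F] --> (0 : R).
Proof.
move=> fN /fine_cvgP[Nfin N0].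
apply: (@squeeze_cvgr _ _ _ _ (fun=> 0 : R) (fine \o N)) => //; last exact: cvg_cst.
near=> i; have [f0 fNi] : 0 <= f i /\ ((f i)%:E <= N i)%E by near: i.
have Ni : N i \is a fin_num by near: i.
by rewrite f0 -lee_fin /= fineK.
Unshelve. all: by end_near. Qed.

Lemma C0T_sip_cont T (X : set (vfield R)) N u : C0T T X N u ->
  (forall v, X v -> vL2 O v) ->
  (forall v, vL2 O v -> ((vip O v v)%:E <= N v)%E) ->
  sip_cont (vL2 O) (vip O) T u.
Proof.
move=> [Xu cu] XL LN; split=> t tT; first by apply: XL; exact: Xu.
apply: ereal_squeeze0 (cu t tT).
near=> s; split; first exact: vip_ge0.
have sT : s \in `[0, T] by near: s; exact: withinT.
by apply: LN; apply: (sipXB S); apply: XL; exact: Xu.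
Unshelve. all: by end_near. Qed.

Lemma C1T_sip_diff T (X : set (vfield R)) N u du : C1T T X N u du ->
  (forall v, X v -> vL2 O v) ->
  (forall v, vL2 O v -> ((vip O v v)%:E <= N v)%E) ->
  sip_diff (vip O) T u du.
Proof.
move=> [[Xu _] [Xdu _] hu] XL LN t tT; apply: ereal_squeeze0 (hu t tT).
near=> s; split; first exact: vip_ge0.
have sT : s \in `[0, T] by near: s; exact: withinT.
have [Lus Lut] : vL2 O (u s) /\ vL2 O (u t) by split; apply: XL; exact: Xu.
apply: LN; apply: (sipXB S); last by apply: XL; exact: Xdu.
by apply: (sipXZ S); exact: (sipXB S).
Unshelve. all: by end_near. Qed.

Lemma C0T_wdiv_cont T (X : set (vfield R)) u : C0T T X (hdivsq O) u ->
  (forall v, X v -> Hdiv O v) ->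
  sip_cont (L2 O) (ip O) T (fun t => wdiv O (u t)).
Proof.
move=> [Xu cu] XH; split=> t tT; first by apply: L2_wdiv; apply: XH; exact: Xu.
apply: ereal_squeeze0 (cu t tT).
near=> s; split; first exact: ip_ge0.
have sT : s \in `[0, T] by near: s; exact: withinT.
rewrite hdivsqB//; [|by apply: XH; exact: Xu..].
by rewrite lee_fin lerDr vip_ge0.
Unshelve. all: by end_near. Qed.

Lemma simple_fun_sub (X Y : set (vfield R)) s : (forall v, X v -> Y v) ->
  simple_fun X s -> simple_fun Y s.
Proof.
move=> XY [n [A [a [AX es]]]]; exists n, A, a; split=> // i.
by have [mA Xa] := AX i; split=> //; exact: XY.
Qed.

(* Strong measurability makes the pairings with [e] measurable only off a null
   set [A]; [g] is 0 on [A]. *)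
Lemma L2T_modification T e : L2T T (Hdiv O) (hdivsq O) e ->
  exists (A : set (measurableTypeR R)) (g : R -> vfield R),
  [/\ measurable A, mu A = 0%E, sip_L2 (vL2 O) (vip O) T g &
      forall t, t \in `]0, T[ -> ~ A t -> g t = e t].
Proof.
move=> [Xe [s [ss [A [mA A0 subA]]]] Ie].
pose D : set (measurableTypeR R) := `]0, T[ `\` A.
have mD : measurable D by apply: measurableD => //; exact: measurable_itv.
have DT : D `<=` `[0, T] by move=> t [/subset_itv_oo_cc].
have Le t : D t -> vL2 O (e t) by move=> [/= /Xe[]].
have svL2 n : simple_fun (vL2 O) (s n) by apply: simple_fun_sub (ss n) => v [].
have se t : D t -> vip O (s n t - e t) (s n t - e t) @[n --> \oo] --> (0 : R).
  move=> Dt; have [tT nAt] := Dt.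
  have cvs : hdivsq O (s n t - e t) @[n --> \oo] --> 0%E.
    by apply: contrapT => H; apply: nAt; apply: subA => /= /(_ tT).
  apply: ereal_squeeze0 cvs; apply: nearW => n; split; first exact: vip_ge0.
  apply: vip_le_hdivsq; apply: (sipXB S); last exact: Le.
  have [m [A' [a [AX ->]]]] := ss n; elim/big_ind : _ => //.
  - exact: (sip0 S).
  - by move=> x y; exact: (sipXD S).
  - by move=> i _; apply: (sipXZ S); have [_ []] := AX i.
have wm : weakly_measurable (vL2 O) (vip O) D e.
  exact: (weakly_measurable_strong S Le svL2 se).
pose g t := if t \in D then e t else 0.
have gE (v : R -> vfield R) :
    (fun t => vip O (g t) (v t)) = (fun t => vip O (e t) (v t)) \_ D.
  by apply/funext => t; rewrite /g /patch; case: ifP => // _; rewrite vipC vip0r.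
have mg (v : R -> vfield R) : weakly_measurable (vL2 O) (vip O) D v ->
    measurable_fun `[0, T] (fun t => vip O (g t) (v t)).
  move=> wv; rewrite gE; apply/measurable_restrict => //; rewrite (setIidr DT).
  exact: (measurable_sip_strong S wv Le svL2 se).
have hdiv_ge0 v : (0 <= hdivsq O v)%E.
  apply: adde_ge0; apply: integral_ge0 => x _; rewrite lee_fin ?sqr_ge0//.
  by apply: sumr_ge0 => i _; rewrite -expr2 sqr_ge0.
exists A, g; split => //; last first.
  by move=> t tT nAt; rewrite /g mem_set.
split.
- by move=> t; rewrite /g; case: ifPn => [/set_mem/Le//|_]; exact: (sip0 S).
- apply/integrableP; split.
    apply/measurable_EFinP; apply: mg; split=> [t Dt|w Lw].
      by rewrite /g mem_set//; exact: Le.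
    apply: (eq_measurable_fun (fun t => vip O w (e t))) (wm.2 w Lw) => t tD.
    by rewrite /g tD.
  (* No measurability in time of [hdivsq O (e t)] is at hand, hence the comparison by
     [ge0_le_integral_any]. *)
  apply: le_lt_trans Ie; rewrite integral_mkcond [leRHS]integral_mkcond.
  apply: ge0_le_integral_any => t _; first by apply: erestrict_ge0 => x _; exact: abse_ge0.
  rewrite /patch; case: ifPn => [tT|_]; last by case: ifP.
  rewrite /g; case: ifPn => [/set_mem Dt|_]; last first.
    by rewrite vip0r//= normr0; case: ifP.
  have [tT' _] := Dt; rewrite mem_set// gee0_abs ?lee_fin ?vip_ge0//.
  by apply: vip_le_hdivsq; exact: Le.
- move=> v cv; apply: mg; exact: (sip_cont_weakly_measurable S mD DT cv).
Qed.

End TimeRegularity.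

(** * Energy balance, absorption and integration in time *)

Section EnergyEstimate.
Context {R : realType} (O : set (pt R)) (oO : open O) (bO : bounded_set O).
Variables (eta mu0 sigma tau chi0 beta : R).
Hypotheses (eta_gt0 : 0 < eta) (mu0_gt0 : 0 < mu0) (sigma_gt0 : 0 < sigma).
Hypotheses (tau_gt0 : 0 < tau) (chi0_gt0 : 0 < chi0) (beta_gt0 : 0 < beta).
Variables (T : R) (He dHe u du : R -> vfield R) (p : R -> sfield R).
Variables (m dm z k H : R -> vfield R) (phi : R -> sfield R).
Hypotheses (T0 : 0 < T) (HHe : H1T_Hdiv O T He dHe).
Hypothesis tr_He : forall t, t \in `]0, T] -> zero_normal_trace O (He t).
Hypotheses (Hu : C1T T (spS O) (spSsq O) u du) (Hp : C0T T (spW O) (nsq O) p).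
Hypotheses (Hm : C1T T (spV O) (hdivsq O) m dm) (Hz : C0T T (spU O) (hcurlsq O) z).
Hypotheses (Hk : C0T T (spU O) (hcurlsq O) k) (HH : C0T T (spV O) (hdivsq O) H).
Hypothesis Hphi : C0T T (spW O) (nsq O) phi.
Hypothesis WP : forall t, t \in `]0, T] ->
  WP_at O eta mu0 sigma tau chi0 beta (u t) (du t) (p t) (m t) (dm t)
    (z t) (k t) (H t) (phi t) (He t).
Local Notation mu := (@lebesgue_measure R).

Let mO : measurable O. Proof. exact: open_pt_measurable. Qed.
Let S := vip_semi_ip mO.

Let Vdiv v : spV O v -> Hdiv O v. Proof. by case. Qed.

Let cHe : sip_cont (vL2 O) (vip O) T He.
Proof.
have [_ _ h _] := HHe; apply: (C0T_sip_cont oO h) => [v []//|v]; exact: vip_le_hdivsq.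
Qed.
Let cu : sip_cont (vL2 O) (vip O) T u.
Proof.
have [h _ _] := Hu; apply: (C0T_sip_cont oO h); first exact: spS_vL2.
exact: vip_le_spSsq.
Qed.
Let cdu : sip_cont (vL2 O) (vip O) T du.
Proof.
have [_ h _] := Hu; apply: (C0T_sip_cont oO h); first exact: spS_vL2.
exact: vip_le_spSsq.
Qed.
Let hu : sip_diff (vip O) T u du.
Proof. by apply: (C1T_sip_diff oO Hu); [exact: spS_vL2|exact: vip_le_spSsq]. Qed.
Let cm : sip_cont (vL2 O) (vip O) T m.
Proof.
have [h _ _] := Hm; apply: (C0T_sip_cont oO h); first exact: spV_vL2.
exact: vip_le_hdivsq.
Qed.
Let cdm : sip_cont (vL2 O) (vip O) T dm.
Proof.
have [_ h _] := Hm; apply: (C0T_sip_cont oO h); first exact: spV_vL2.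
exact: vip_le_hdivsq.
Qed.
Let hm : sip_diff (vip O) T m dm.
Proof. by apply: (C1T_sip_diff oO Hm); [exact: spV_vL2|exact: vip_le_hdivsq]. Qed.
Let cH : sip_cont (vL2 O) (vip O) T H.
Proof.
apply: (C0T_sip_cont oO HH); first exact: spV_vL2.
exact: vip_le_hdivsq.
Qed.
Let cdivm : sip_cont (L2 O) (ip O) T (fun t => wdiv O (m t)).
Proof. by have [h _ _] := Hm; exact: (C0T_wdiv_cont oO bO h). Qed.
Let cdivHe : sip_cont (L2 O) (ip O) T (fun t => wdiv O (He t)).
Proof. by have [_ _ h _] := HHe; exact: (C0T_wdiv_cont oO bO h). Qed.

Let memT t : t \in `]0, T] -> [/\ spS O (u t), spV O (m t), spU O (z t), spU O (k t) &
  spV O (H t) /\ spV O (He t)].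
Proof.
move=> tT; have tT' : t \in `[0, T] by exact: subset_itv_oc_cc.
have [[hu' _] _ _] := Hu; have [[hm' _] _ _] := Hm.
have [_ _ [hHe _] _] := HHe.
split; [exact: hu'|exact: hm'|exact: (Hz.1)|exact: (Hk.1)|].
by split; [exact: HH.1|split; [exact: hHe|exact: tr_He]].
Qed.

Let memW t : t \in `]0, T] -> spW O (p t) /\ spW O (phi t).
Proof.
move=> tT; have tT' : t \in `[0, T] by exact: subset_itv_oc_cc.
by split; [exact: Hp.1|exact: Hphi.1].
Qed.

(** The static equations at two different times may be combined: the one for [H] at time [s], tested
    with fields at time [t], and the magnetostatic one at time [t], tested with [phi s], share
    [phi s], which drops out. *)
Let field_identity s t : s \in `]0, T] -> t \in `]0, T] ->
  vip O (H s) (H t) = - vip O (H s) (m t) - vip O (H s) (He t).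
Proof.
move=> sT tT; have [_ Vm _ _ [VH VHe]] := memT tT; have [_ Wphi] := memW sT.
rewrite !(field_pairing (WP sT))//.
have := wdiv_balance oO (WP tT) Vm VH Wphi; pairing_lra.
Qed.

Variables (A : set (measurableTypeR R)) (g : R -> vfield R).
Hypotheses (mA : measurable A) (A0 : mu A = 0%E) (Lg : sip_L2 (vL2 O) (vip O) T g).
Hypothesis gE : forall t, t \in `]0, T[ -> ~ A t -> g t = dHe t.

Let increment_m w s t : vL2 O w -> 0 < s -> s <= t -> t < T ->
  vip O (m t) w - vip O (m s) w = \int[mu]_(r in `[s, t]) vip O (dm r) w.
Proof.
move=> Lw s0 st tT.
have hw : sip_diff (vip O) T (fun=> w) (fun=> 0).
  move=> r _; rewrite (_ : (fun s' => _) = cst 0); first exact: cvg_cst.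
  by apply/funext => s'; rewrite subrr scaler0 subrr vip0r.
have := sip_FTC S cm (sip_cont_cst S T Lw) cdm (sip_cont_cst S T (sip0 S)) hm hw
  (ltW s0) st (ltW tT).
move=> <-; apply: eq_Rintegral => r _.
have : vip O (m r) 0 = 0 by exact: vip0r.
by move=> /= ->; rewrite addr0.
Qed.

Let increment_He w s t : vL2 O w -> 0 < s -> s <= t -> t < T ->
  vip O (He t) w - vip O (He s) w = \int[mu]_(r in `[s, t]) vip O (g r) w.
Proof.
move=> Lw s0 st tT; have cw := sip_cont_cst S T Lw.
apply: (@weak_FTC _ T (fun r => vip O (He r) w) (fun r => vip O (g r) w)) => //.
- exact: (sip_cont_within S cHe cw).
- exact: (sip_L2_integrable S Lg cw).
move=> f tf; have [_ _ _ h] := HHe; apply: (etrans (h f w tf Lw)); apply: congr1.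
by apply: (eq_Rintegral_off mA A0) => r rT nAr; rewrite gE.
Qed.

Let increment s t : 0 < s -> s <= t -> t < T ->
  vip O (H t) (H t) - vip O (H s) (H s) = - \int[mu]_(r in `[s, t])
    (vip O (dm r) (H s + H t) + vip O (g r) (H s + H t)).
Proof.
move=> s0 st tT.
have sT : s \in `]0, T] by rewrite in_itv/= s0 (le_trans st (ltW tT)).
have tT' : t \in `]0, T] by rewrite in_itv/= (lt_le_trans s0 st) ltW.
have inT r : r \in `]0, T] -> r \in `[0, T] by exact: subset_itv_oc_cc.
have LH r : r \in `]0, T] -> vL2 O (H r) by move=> /inT/cH.1.
have Lm r : r \in `]0, T] -> vL2 O (m r) by move=> /inT/cm.1.
have LHe r : r \in `]0, T] -> vL2 O (He r) by move=> /inT/cHe.1.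
have [LHs LHt] := (LH _ sT, LH _ tT').
have [Lms Lmt] := (Lm _ sT, Lm _ tT').
have [LHes LHet] := (LHe _ sT, LHe _ tT').
have Lw : vL2 O (H s + H t) by exact: (sipXD S).
have sub : [set` `[s, t]] `<=` [set` `[0, T]].
  by move=> r /=; rewrite !in_itv/= => /andP[sr rt];
    rewrite (le_trans (ltW s0) sr) (le_trans rt (ltW tT)).
have cw := sip_cont_cst S T Lw.
rewrite RintegralD//; last 2 first.
- by apply: integrableS (sip_cont_integrable S cdm cw).
- by apply: integrableS (sip_L2_integrable S Lg cw).
rewrite -increment_m// -increment_He//.
rewrite !(sipDr S)//.
(* All four pairs of times are used: [(H s, H t)], expressed in two ways, accounts for the mixed
   terms. *)
have := field_identity sT sT; have := field_identity sT tT'.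
have := field_identity tT' sT; have := field_identity tT' tT'.
rewrite (vipC O (H t) (H s)) (vipC O (H s) (m s)) (vipC O (H s) (m t)).
rewrite (vipC O (H t) (m s)) (vipC O (H t) (m t)).
rewrite (vipC O (H s) (He s)) (vipC O (H s) (He t)).
rewrite (vipC O (H t) (He s)) (vipC O (H t) (He t)).
pairing_lra.
Qed.

Let en t := vip O (u t) (u t) + vip O (m t) (m t) + mu0 * vip O (H t) (H t).

(* [L] is the derivative of the energy; [Q] is the dissipation as rewritten by
   [dissipation_identity], whose integrability in time is evident. *)
Let L r := (vip O (du r) (u r) + vip O (u r) (du r))
  + (vip O (dm r) (m r) + vip O (m r) (dm r))
  - mu0 * (2 * (vip O (dm r) (H r) + vip O (g r) (H r))).

Let Q r := 2 * (- vip O (du r) (u r) - vip O (dm r) (m r) + mu0 * vip O (dm r) (H r)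
  - mu0 * sigma * ip O (wdiv O (He r)) (wdiv O (m r))
  - (mu0 + chi0) / tau * vip O (H r) (He r)).

Let G r := vip O (He r) (He r) + ip O (wdiv O (He r)) (wdiv O (He r))
  + vip O (g r) (g r).

Let Ic v w : sip_cont (vL2 O) (vip O) T v -> sip_cont (vL2 O) (vip O) T w ->
  mu.-integrable `[0, T] (EFin \o (fun r => vip O (v r) (w r))).
Proof. exact: (sip_cont_integrable S). Qed.

Let IL : mu.-integrable `[0, T] (EFin \o L).
Proof.
apply: itv_integrableB.
  by apply: itv_integrableD; apply: itv_integrableD; exact: Ic.
apply: itv_integrableZ; apply: itv_integrableZ; apply: itv_integrableD.
  exact: Ic.
exact: (sip_L2_integrable S Lg cH).
Qed.

Let IQ : mu.-integrable `[0, T] (EFin \o Q).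
Proof.
apply: itv_integrableZ; apply: itv_integrableB; last first.
  by apply: itv_integrableZ; exact: Ic.
apply: itv_integrableB; last first.
  apply: itv_integrableZ; exact: (sip_cont_integrable (ip_semi_ip mO)).
apply: itv_integrableD; last by apply: itv_integrableZ; exact: Ic.
apply: itv_integrableB; last exact: Ic.
rewrite (_ : (fun r => - _) = fun r => -1 * vip O (du r) (u r)).
  by apply: itv_integrableZ; exact: Ic.
by apply/funext => r; rewrite mulN1r.
Qed.

Let IG : mu.-integrable `[0, T] (EFin \o G).
Proof.
apply: itv_integrableD; last exact: sip_L2_int Lg.
apply: itv_integrableD; first exact: Ic.
exact: (sip_cont_integrable (ip_semi_ip mO)).
Qed.

Let energy_balance t : t \in `[0, T] -> en t - en 0 = \int[mu]_(r in `[0, t]) L r.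
Proof.
move=> tT; move: (tT); rewrite in_itv/= => /andP[t0 tleT].
have sub : [set` `[0, t]] `<=` [set` `[0, T]].
  by move=> r /=; rewrite !in_itv/= => /andP[-> rt]; exact: le_trans tleT.
have I0t f : mu.-integrable `[0, T] (EFin \o f) -> mu.-integrable `[0, t] (EFin \o f).
  by apply: integrableS.
have Iu : mu.-integrable `[0, t]
    (EFin \o (fun r => vip O (du r) (u r) + vip O (u r) (du r))).
  by apply: I0t; apply: itv_integrableD; exact: Ic.
have Im : mu.-integrable `[0, t]
    (EFin \o (fun r => vip O (dm r) (m r) + vip O (m r) (dm r))).
  by apply: I0t; apply: itv_integrableD; exact: Ic.
have IH : mu.-integrable `[0, t]
    (EFin \o (fun r => 2 * (vip O (dm r) (H r) + vip O (g r) (H r)))).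
  apply: I0t; apply: itv_integrableZ; apply: itv_integrableD; first exact: Ic.
  exact: (sip_L2_integrable S Lg cH).
rewrite RintegralB//; [|exact: itv_integrableD|exact: itv_integrableZ].
rewrite RintegralD// RintegralZl//.
rewrite (sip_FTC S cu cu cdu cdu hu hu)// (sip_FTC S cm cm cdm cdm hm hm)//.
have h := quadratic_chain_rule S T0 cH cdm Lg increment tT; rewrite /en.
rewrite -[\int[mu]_(x in _) _]opprK -h; pairing_lra.
Qed.

Let Acoef := tau^-1 * (mu0 * (1 + chi0) + chi0).
Let acoef := (mu0 + chi0) / tau.

Let dissipation_Q r : r \in `]0, T] ->
  dissipation O eta mu0 sigma tau chi0 beta (u r) (m r) (k r) (H r) = (Q r)%:E.
Proof.
move=> rT; have [Su Vm Uz Uk [VH VHe]] := memT rT; have [Wp Wphi] := memW rT.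
rewrite (dissipationE oO (WP rT))//; congr (2 * _)%:E.
exact: (dissipation_identity oO bO (WP rT)).
Qed.

(** Keeps just the two dissipative terms against which the forcing is absorbed. *)
Let Q_lower r : r \in `]0, T] ->
  2 * (sigma * (1 + mu0) * ip O (wdiv O (m r)) (wdiv O (m r))
       + Acoef * vip O (H r) (H r)) <= Q r.
Proof.
move=> rT; have [Su Vm Uz Uk [VH VHe]] := memT rT; have [Wp Wphi] := memW rT.
rewrite /Q; have <- := (dissipation_identity oO bO (WP rT) Su Vm Uz Uk VH VHe Wp Wphi).
have h1 : 0 <= eta * tip O (wgrad O (u r)) (wgrad O (u r)).
  apply: mulr_ge0 (ltW eta_gt0) _; apply: Rintegral_ge0 => x _.
  by apply: sumr_ge0 => i _; apply: sumr_ge0 => j _; rewrite -expr2 sqr_ge0.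
have h2 : 0 <= sigma * vip O (k r) (k r) by rewrite mulr_ge0 ?vip_ge0// ltW.
have h3 : 0 <= tau^-1 * vip O (m r) (m r) by rewrite mulr_ge0 ?vip_ge0// invr_ge0 ltW.
have h4 : 0 <= mu0 * beta * vip O (cross (m r) (H r)) (cross (m r) (H r)).
  by rewrite !mulr_ge0 ?vip_ge0// ltW.
rewrite ler_pM2l// /Acoef; move: h1 h2 h3 h4.
move: (eta * _) (sigma * vip _ _ _) (tau^-1 * vip _ _ _) (mu0 * beta * _) => a b c d.
move: (sigma * (1 + mu0) * _) (tau^-1 * _ * _) => e f; lra.
Qed.

(** One summand for each forcing pairing: div He with div m, [He] with [H], and the time derivative
    of [He] with [H]. Their sum bounds each coefficient. *)
Let C2 := mu0 * sigma + 2 * acoef ^+ 2 / Acoef + 2 * mu0 ^+ 2 / Acoef.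

Let Acoef_gt0 : 0 < Acoef.
Proof. by rewrite mulr_gt0 ?invr_gt0// addr_gt0// mulr_gt0// addr_gt0. Qed.

Let acoef_gt0 : 0 < acoef.
Proof. by rewrite divr_gt0// addr_gt0. Qed.

(** The weight [Acoef / (2 * a)] makes each of the two pairings with [H] cost [Acoef / 2] times
    |H|^2; together they use up the |H|^2 term in half of the dissipation. *)
Let young a x y : 0 < a -> vL2 O x -> vL2 O y ->
  - (2 * (a * vip O x y)) <=
    Acoef / 2 * vip O x x + 2 * a ^+ 2 / Acoef * vip O y y.
Proof.
move=> a0 Lx Ly; have e0 : 0 < Acoef / (2 * a) by rewrite divr_gt0// mulr_gt0.
have := ler_wpM2l (ltW a0) (sip_young S e0 Lx Ly); rewrite invf_div.
rewrite (_ : a * (Acoef / (2 * a) * _ + _) =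
  Acoef / 2 * vip O x x + 2 * a ^+ 2 / Acoef * vip O y y); last first.
  by field; rewrite !gt_eqF.
by apply: le_trans; rewrite mulrCA -!mulrN !ler_pM2l// -normrN ler_norm.
Qed.

Let L_upper r : r \in `]0, T] -> L r <= C2 * G r - 2^-1 * Q r.
Proof.
move=> rT; have [Su Vm Uz Uk [VH VHe]] := memT rT.
have Lgr : vL2 O (g r) by apply: (sip_L2_mem Lg); exact: subset_itv_oc_cc.
have [LH LHe] := (spV_vL2 VH, spV_vL2 VHe).
have dm2 := L2_wdiv Vm.1; have dHe2 := L2_wdiv VHe.1.
have y1 := sip_young (ip_semi_ip mO) (ltr01 : 0 < 1 :> R) dHe2 dm2.
have {}y1 : - (2 * ip O (wdiv O (He r)) (wdiv O (m r))) <=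
    ip O (wdiv O (He r)) (wdiv O (He r)) + ip O (wdiv O (m r)) (wdiv O (m r)).
  move: y1; move: (ip O _ _) (ip O _ _) (ip O _ _) => a b c.
  rewrite invr1 (mul1r b) (mul1r a); apply: le_trans.
  by rewrite -mulrN ler_pM2l// -normrN ler_norm.
have {}y1 := ler_wpM2l (ltW (mulr_gt0 mu0_gt0 sigma_gt0)) y1.
have y2 := young acoef_gt0 LH LHe; have y3 := young mu0_gt0 LH Lgr.
have q := Q_lower rT.
have d0 := mulr_ge0 (ltW sigma_gt0) (ip_ge0 O (wdiv O (m r))).
(* The terms with [du] and [dm] agree in [L] and [- Q], so only the forcing pairings remain. The one
   with div m costs [mu0 * sigma], below the available [sigma * (1 + mu0)]. *)
have LQ : L r = - Q r - 2 * (mu0 * sigma * ip O (wdiv O (He r)) (wdiv O (m r)))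
    - 2 * (acoef * vip O (H r) (He r)) - 2 * (mu0 * vip O (H r) (g r)).
  rewrite /L /Q (vipC O (u r)) (vipC O (m r) (dm r)) (vipC O (g r)) -/acoef; ring.
have CG : mu0 * sigma * ip O (wdiv O (He r)) (wdiv O (He r))
    + 2 * acoef ^+ 2 / Acoef * vip O (He r) (He r)
    + 2 * mu0 ^+ 2 / Acoef * vip O (g r) (g r) <= C2 * G r.
  rewrite /C2 /G.
  have := vip_ge0 O (He r); have := vip_ge0 O (g r); have := ip_ge0 O (wdiv O (He r)).
  move: dm2 dHe2 {y1 y2 y3 q d0 LQ} => _ _.
  have : 0 <= mu0 * sigma by rewrite ltW// mulr_gt0.
  have : 0 <= 2 * acoef ^+ 2 / Acoef by rewrite ltW// divr_gt0// mulr_gt0// exprn_gt0.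
  have : 0 <= 2 * mu0 ^+ 2 / Acoef by rewrite ltW// divr_gt0// mulr_gt0// exprn_gt0.
  move: (mu0 * sigma) (2 * acoef ^+ 2 / Acoef) (2 * mu0 ^+ 2 / Acoef) => c1 c2 c3.
  move: (vip O (He r) _) (ip O _ _) (vip O (g r) _) => x y w.
  move=> c3_0 c2_0 c1_0 y0 w0 x0.
  have := mulr_ge0 c1_0 x0; have := mulr_ge0 c1_0 w0.
  have := mulr_ge0 c2_0 y0; have := mulr_ge0 c2_0 w0.
  have := mulr_ge0 c3_0 x0; have := mulr_ge0 c3_0 y0; nra.
rewrite LQ; move: CG y1 y2 y3 q d0.
move: (C2 * G r) (Q r) => cg q.
move: (2 * acoef ^+ 2 / Acoef * _) (2 * mu0 ^+ 2 / Acoef * _) => a1 a2.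
move: (vip O (H r) (He r)) (vip O (H r) (g r)) (vip O (H r) (H r)) => hh hg h2.
move: (ip O (wdiv O (He r)) (wdiv O (m r))) (ip O (wdiv O (m r)) _) (ip O _ _) => b1 b2 b3.
move: Acoef acoef => A1 A2; lra.
Qed.

Let energy_estimate_real t : t \in `[0, T] ->
  en t + 2^-1 * \int[mu]_(r in `[0, t]) Q r <= en 0 + C2 * \int[mu]_(r in `[0, t]) G r.
Proof.
move=> tT; have := energy_balance tT; move: (tT); rewrite in_itv/= => /andP[t0 tleT].
have sub : [set` `[0, t]] `<=` [set` `[0, T]].
  by move=> r /=; rewrite !in_itv/= => /andP[-> rt]; exact: le_trans tleT.
have I0t f : mu.-integrable `[0, T] (EFin \o f) -> mu.-integrable `[0, t] (EFin \o f).
  by apply: integrableS.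
have toc : [set` `]0, t]] `<=` [set` `[0, t]] by exact: subset_itv_oc_cc.
have I1 := I0t _ IL.
have I2 : mu.-integrable `[0, t] (EFin \o (fun r => C2 * G r - 2^-1 * Q r)).
  by apply: I0t; apply: itv_integrableB; exact: itv_integrableZ.
have : \int[mu]_(r in `[0, t]) L r <= \int[mu]_(r in `[0, t]) (C2 * G r - 2^-1 * Q r).
  rewrite -!Rintegral_itv_obnd_cbnd; [|exact: integrableS I2|exact: integrableS I1].
  apply: le_Rintegral => //; [exact: integrableS I1|exact: integrableS I2|].
  move=> r /= rt; apply: L_upper; move: rt; rewrite !in_itv/= => /andP[-> rt].
  exact: le_trans tleT.
have [IG' IQ'] := (I0t _ IG, I0t _ IQ).
move: (\int[mu]_(r in _) L r) => a; rewrite RintegralB//; [|exact: itv_integrableZ..].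
rewrite (RintegralZl C2 _ IG')// (RintegralZl 2^-1 _ IQ')//.
move: (en t) (en 0) (C2 * _) (2^-1 * _) => b c d e; lra.
Qed.

Let energyE t : t \in `[0, T] -> energy O mu0 (u t) (m t) (H t) = (en t)%:E.
Proof.
by move=> tT; rewrite /energy !(vnsqE mO); [|exact: cH.1|exact: cm.1|exact: cu.1].
Qed.

Let EFin_Rintegral t f : t \in `[0, T] -> mu.-integrable `[0, T] (EFin \o f) ->
  (\int[mu]_(r in `[0%R, t]) (f r)%:E)%E = (\int[mu]_(r in `[0, t]) f r)%:E.
Proof.
rewrite in_itv/= => /andP[_ tleT] If; rewrite /Rintegral fineK//.
apply: integrable_fin_num => //; apply: integrableS If => //.
by move=> r /=; rewrite !in_itv/= => /andP[-> rt]; exact: le_trans tleT.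
Qed.

Lemma energy_estimate t : t \in `[0, T] ->
  (energy O mu0 (u t) (m t) (H t)
   + (2^-1)%:E * \int[mu]_(s in `[0%R, t])
       dissipation O eta mu0 sigma tau chi0 beta (u s) (m s) (k s) (H s)
   <= energy O mu0 (u 0%R) (m 0%R) (H 0%R)
   + (mu0 * sigma + 2 * ((mu0 + chi0) / tau) ^+ 2 / (tau^-1 * (mu0 * (1 + chi0) + chi0))
      + 2 * mu0 ^+ 2 / (tau^-1 * (mu0 * (1 + chi0) + chi0)))%:E
     * \int[mu]_(s in `[0%R, t]) (hdivsq O (He s) + vnsq O (dHe s)))%E.
Proof.
move=> tT; rewrite -/Acoef -/acoef -/C2 !energyE//; last first.
  by rewrite in_itv/= lexx ltW.
have inT r : r \in `[0, t] -> r != 0 -> r \in `]0, T].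
  move: tT; rewrite !in_itv/= => /andP[_ tT] /andP[r0 rt] rN0.
  by rewrite lt_neqAle eq_sym rN0 r0 (le_trans rt).
have -> : (\int[mu]_(s in `[0%R, t])
    dissipation O eta mu0 sigma tau chi0 beta (u s) (m s) (k s) (H s) =
    \int[mu]_(s in `[0%R, t]) (Q s)%:E)%E.
  (* The equations are assumed for positive times only, so time 0 is discarded as a null set. *)
  apply: (@eq_integral_off _ _ _ mu [set 0]) => //; first exact: lebesgue_measure_set1.
  by move=> r rt /eqP r0; rewrite dissipation_Q// inT.
have -> : (\int[mu]_(s in `[0%R, t]) (hdivsq O (He s) + vnsq O (dHe s)) =
    \int[mu]_(s in `[0%R, t]) (G s)%:E)%E.
  (* [g] represents the time derivative of [He] only off [A] and strictly inside the interval. *)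
  apply: (@eq_integral_off _ _ _ mu (A `|` ([set 0] `|` [set T]))).
  - by apply: measurableU => //; exact: measurableU.
  - have pt0 (c : R) : mu [set c] = 0%E by exact: lebesgue_measure_set1.
    by rewrite measureU0 ?measureU0//; [exact: measurableU|exact: pt0..].
  move=> r rt /not_orP[nAr /not_orP[/eqP r0 /eqP rNT]].
  have rT := inT r rt r0; have [_ _ _ _ [_ VHe]] := memT rT.
  have rT' : r \in `]0, T[ by move: rT; rewrite !in_itv/= (lt_neqAle r T) rNT => /andP[-> ->].
  rewrite hdivsqE//; last exact: Vdiv.
  by rewrite -gE// (vnsqE mO)//; apply: (sip_L2_mem Lg); exact: subset_itv_oc_cc.
by rewrite !EFin_Rintegral// -!EFinM -!EFinD lee_fin; exact: energy_estimate_real.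
Qed.

End EnergyEstimate.

Theorem theorem2p2 (R : realType) (O : set (pt R))
    (eta mu0 sigma tau chi0 beta : R) :
  admissible_domain O ->
  0 < eta -> 0 < mu0 -> 0 < sigma -> 0 < tau -> 0 < chi0 -> 0 < beta ->
  exists C1 C2 : R, [/\ 0 < C1, 0 < C2 &
  forall (T : R) (u0 m0 : vfield R) (He dHe u du : R -> vfield R)
    (p : R -> sfield R) (m dm z k H : R -> vfield R) (phi : R -> sfield R),
  0 < T ->
  H1T_Hdiv O T He dHe ->
  (forall t, t \in `]0, T] -> zero_normal_trace O (He t)) ->
  C1T T (spS O) (spSsq O) u du ->
  C0T T (spW O) (nsq O) p ->
  C1T T (spV O) (hdivsq O) m dm ->
  C0T T (spU O) (hcurlsq O) z ->
  C0T T (spU O) (hcurlsq O) k ->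
  C0T T (spV O) (hdivsq O) H ->
  C0T T (spW O) (nsq O) phi ->
  (forall t, t \in `]0, T] ->
     WP_at O eta mu0 sigma tau chi0 beta (u t) (du t) (p t) (m t) (dm t)
       (z t) (k t) (H t) (phi t) (He t)) ->
  (forall i, ae_eq leb3 O (u 0 i) (u0 i)) ->
  (forall i, ae_eq leb3 O (m 0 i) (m0 i)) ->
  forall t, t \in `[0, T] ->
  (energy O mu0 (u t) (m t) (H t)
   + C1%:E * \int[lebesgue_measure]_(s in `[0%R, t])
       dissipation O eta mu0 sigma tau chi0 beta (u s) (m s) (k s) (H s)
   <= energy O mu0 (u 0%R) (m 0%R) (H 0%R)
   + C2%:E * \int[lebesgue_measure]_(s in `[0%R, t])
       (hdivsq O (He s) + vnsq O (dHe s)))%E].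
Proof.
move=> [[_ oO] bO _ _ _] eta0 mu0_0 sigma0 tau0 chi0_0 beta0.
exists 2^-1, (mu0 * sigma + 2 * ((mu0 + chi0) / tau) ^+ 2 / (tau^-1 * (mu0 * (1 + chi0) + chi0))
      + 2 * mu0 ^+ 2 / (tau^-1 * (mu0 * (1 + chi0) + chi0))).
split; first by rewrite invr_gt0.
  by rewrite !(addr_gt0, mulr_gt0, invr_gt0, exprn_gt0).
move=> T u0 m0 He dHe u du p m dm z k H phi T0 HHe tr_He Hu Hp Hm Hz Hk HH Hphi WP _ _ t tT.
have [_ L2dHe _ _] := HHe.
have [A [g [mA A0 Lg gE]]] := L2T_modification oO L2dHe.
exact: (energy_estimate oO bO eta0 mu0_0 sigma0 tau0 chi0_0 beta0 T0 HHe tr_He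
  Hu Hp Hm Hz Hk HH Hphi WP mA A0 Lg gE tT).
Qed.
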